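(* Let $k\ge1$ and $d\in\mathbb Z$. The map on generators $$\Delta(\mu)=\mu\otimes\mu,\qquad \Delta(\nu)=\mu^{\circ k}\otimes\nu+\nu\otimes\mu^{\circ k}$$ extends uniquely to a Hopf structure $\Delta:\mathsf{Pois}^k_d\to\mathsf{Pois}^k_d\otimes\mathsf{Pois}^k_d$ on the operad $\mathsf{Pois}^k_d$ (that is, to a coassociative morphism of operads).
   Context: $\Bbbk$ is a field of characteristic zero; objects are graded with the Koszul sign rule; operads are symmetric; the tensor product of operads is aritywise. $(-1)^{|\sigma|}$ is the sign of a permutation. $\mu^{\circ k}$ denotes the $k$-fold iterated composition of $\mu$, i.e. the product of $k+1$ arguments. $\mathsf{Pois}^k_d$ is the operad generated by a commutative associative binary operation $\mu$ of degree $0$ and a $(k+1)$-ary operation $\nu$ of degree $1-kd$ with $\sigma\cdot\nu=(-1)^{d|\sigma|}\nu$ for $\sigma\in\mathbb S_{k+1}$, subject to associativity of $\mu$, the generalized Jacobi identity $$\sum_{\sigma}\nu(\nu(x_{\sigma(1)},\dots,x_{\sigma(k+1)}),x_{\sigma(k+2)},\dots,x_{\sigma(2k+1)})=0$$ ($\sigma$ running over even permutations representing the cosets $\mathbb S_{2k+1}/(\mathbb S_{k+1}\times\mathbb S_k)$, one for each coset) and the Leibniz identity (for degree-zero arguments) $$\nu(x_1,\dots,x_k,\mu(x_{k+1},x_{k+2}))=\mu(\nu(x_1,\dots,x_k,x_{k+2}),x_{k+1})+\mu(\nu(x_1,\dots,x_k,x_{k+1}),x_{k+2}).$$ *)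

(* Defs.v *)
(* [boolp] supplies classical quotients of arbitrary types. *)
From HB Require Import structures.
From mathcomp Require Import all_boot all_order all_algebra all_fingroup.
From mathcomp Require Import ring.
From mathcomp Require Import boolp generic_quotient.

Set Implicit Arguments.
Unset Strict Implicit.
Unset Printing Implicit Defensive.

Import GRing.Theory.
Local Open Scope quotient_scope.
Local Open Scope ring_scope.

(* A type of formal expressions, with their evaluations in a class of models.
   Identifying two expressions when all models identify them yields a vector
   space.  The tensor product and the presented operad below are of this form:
   there the quotient is itself a model, so that the relation is the least
   congruence containing the defining relations and the quotient is the initial
   model. *)
Record evaluations (K : fieldType) := Evaluations {
  ev_expr : Type;
  ev_model : Type;
  ev_value : ev_model -> lmodType K;
  ev_eval : forall a : ev_model, ev_expr -> ev_value a;
  ev_zero : ev_expr;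
  ev_add : ev_expr -> ev_expr -> ev_expr;
  ev_scale : K -> ev_expr -> ev_expr;
  ev_eval0 : forall a, ev_eval a ev_zero = 0;
  ev_evalD : forall a x y, ev_eval a (ev_add x y) = ev_eval a x + ev_eval a y;
  ev_evalZ : forall a c x, ev_eval a (ev_scale c x) = c *: ev_eval a x
}.

Section JointQuotient.
Variables (K : fieldType) (E : evaluations K).
Local Notation T := (ev_expr E).
Local Notation ev := (@ev_eval K E).

Definition agree (x y : {classic T}) : bool := `[< forall a, ev a x = ev a y >].

Lemma agree_refl : reflexive agree.
Proof. by move=> x; apply/asboolP. Qed.
Lemma agree_sym : symmetric agree.
Proof. by move=> x y; apply/asboolP/asboolP => h a; rewrite h. Qed.
Lemma agree_trans : transitive agree.
Proof.
by move=> y x z /asboolP h /asboolP h'; apply/asboolP => a; rewrite h h'.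
Qed.

Canonical agree_equiv := EquivRel agree agree_refl agree_sym agree_trans.

Definition jquot := {eq_quot agree_equiv}.
HB.instance Definition _ := Choice.on jquot.

Definition jpi (x : T) : jquot := \pi_jquot (x : {classic T}).
Definition jlift (a : ev_model E) (u : jquot) : ev_value a := ev a (repr u).

Lemma jlift_pi a x : jlift a (jpi x) = ev a x.
Proof.
have /eqmodP/asboolP := reprK (jpi x).
by rewrite /jlift; apply.
Qed.

Lemma jpi_surj u : exists x, u = jpi x.
Proof. by exists (repr u); rewrite /jpi reprK. Qed.

Lemma jlift_inj u v : (forall a, jlift a u = jlift a v) -> u = v.
Proof.
move=> h; rewrite -[u]reprK -[v]reprK; apply/eqmodP/asboolP => a; exact: h.
Qed.

Let j0 : jquot := jpi (ev_zero E).
Let jD (u v : jquot) : jquot := jpi (ev_add (repr u) (repr v)).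
Let jZ (c : K) (u : jquot) : jquot := jpi (ev_scale c (repr u)).
Let jN (u : jquot) : jquot := jZ (-1) u.

Let jlift0 a : jlift a j0 = 0. Proof. by rewrite jlift_pi ev_eval0. Qed.
Let jliftD a u v : jlift a (jD u v) = jlift a u + jlift a v.
Proof. by rewrite jlift_pi ev_evalD. Qed.
Let jliftZ a c u : jlift a (jZ c u) = c *: jlift a u.
Proof. by rewrite jlift_pi ev_evalZ. Qed.

Let jDA : associative jD.
Proof. by move=> u v w; apply: jlift_inj => a; rewrite !jliftD addrA. Qed.
Let jDC : commutative jD.
Proof. by move=> u v; apply: jlift_inj => a; rewrite !jliftD addrC. Qed.
Let j0D : left_id j0 jD.
Proof. by move=> u; apply: jlift_inj => a; rewrite !jliftD jlift0 add0r. Qed.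
Let jND : left_inverse j0 jN jD.
Proof.
by move=> u; apply: jlift_inj => a; rewrite jliftD jliftZ jlift0 scaleN1r addNr.
Qed.

HB.instance Definition _ := GRing.isZmodule.Build jquot jDA jDC j0D jND.

Let jZA c e (u : jquot) : jZ c (jZ e u) = jZ (c * e) u.
Proof. by apply: jlift_inj => a; rewrite !jliftZ scalerA. Qed.
Let jZ1 : left_id 1 jZ.
Proof. by move=> u; apply: jlift_inj => a; rewrite jliftZ scale1r. Qed.
Let jZDr : right_distributive jZ +%R.
Proof.
by move=> c u v; apply: jlift_inj => a; rewrite [LHS]jliftZ !jliftD !jliftZ scalerDr.
Qed.
Let jZDl (u : jquot) : {morph (jZ^~ u : K -> jquot) : c e / c + e}.
Proof.
by move=> c e; apply: jlift_inj => a; rewrite [LHS]jliftZ jliftD !jliftZ scalerDl.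
Qed.

HB.instance Definition _ :=
  GRing.Zmodule_isLmodule.Build K jquot jZA jZ1 jZDr jZDl.

Lemma jlift_linear a : linear (@jlift a).
Proof.
by move=> c u v; rewrite [LHS]jliftD; congr (_ + _); apply: jliftZ.
Qed.
HB.instance Definition _ a :=
  GRing.isLinear.Build K jquot (ev_value a) *:%R (@jlift a) (jlift_linear a).

Lemma jpi_zero : jpi (ev_zero E) = 0. Proof. by []. Qed.
Lemma jpi_add x y : jpi (ev_add x y) = jpi x + jpi y.
Proof. by apply: jlift_inj => a; rewrite linearD /= !jlift_pi ev_evalD. Qed.
Lemma jpi_scale c x : jpi (ev_scale c x) = c *: jpi x.
Proof. by apply: jlift_inj => a; rewrite linearZ /= !jlift_pi ev_evalZ. Qed.
End JointQuotient.

Section LinearMaps.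
Variables (K : fieldType) (U V W : lmodType K).

Lemma lin_Z (f : U -> V) : linear f -> forall c u, f (c *: u) = c *: f u.
Proof.
move=> lf; pose F : {linear U -> V} :=
  HB.pack f (GRing.isLinear.Build K U V *:%R f lf).
exact: (linearZ_LR F).
Qed.

Lemma lin_comp (f : V -> W) (g : U -> V) :
  linear f -> linear g -> linear (fun x => f (g x)).
Proof. by move=> lf lg c u v; rewrite lg lf. Qed.

Lemma lin_scale (c : K) (f : U -> V) :
  linear f -> linear (fun x => c *: f x).
Proof. by move=> lf k u v; rewrite lf scalerDr !scalerA [c * k]mulrC. Qed.
End LinearMaps.

(* Degreewise tensor product of graded vector spaces:
   [gtens A B l] is the direct sum of the [A i (x) B j] over [i + j = l]. *)
Section GradedTensor.
Variables (K : fieldType) (A B : int -> lmodType K).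

Inductive texpr (l : int) : Type :=
| Tpure (i j : int) of l = i + j & A i & B j
| Tzero
| Tadd of texpr l & texpr l
| Tscale of K & texpr l.
Arguments Tzero {l}.

Record bilin (l : int) (W : lmodType K) := Bilin {
  bl_fun :> forall i j : int, l = i + j -> A i -> B j -> W;
  bl_linl : forall (i j : int) (e : l = i + j) b,
    linear (fun a => bl_fun e a b);
  bl_linr : forall (i j : int) (e : l = i + j) a, linear (bl_fun e a)
}.

Fixpoint teval l W (f : bilin l W) (x : texpr l) : W :=
  match x with
  | Tpure i j e a b => f i j e a b
  | Tzero => 0
  | Tadd x y => teval f x + teval f y
  | Tscale c x => c *: teval f x
  end.

Definition tens_evals (l : int) : evaluations K :=
  @Evaluations K (texpr l) {W : lmodType K & bilin l W} (@projT1 _ _)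
    (fun f => teval (projT2 f)) Tzero (@Tadd l) (@Tscale l)
    (fun=> erefl) (fun _ _ _ => erefl) (fun _ _ _ => erefl).

Definition gtens (l : int) : lmodType K := jquot (tens_evals l).

Definition tpure l (i j : int) (e : l = i + j) (a : A i) (b : B j) : gtens l :=
  @jpi K (tens_evals l) (Tpure e a b).

Definition tlift l W (f : bilin l W) (u : gtens l) : W :=
  @jlift K (tens_evals l) (existT (bilin l) W f) u.

Lemma tlift_linear l W (f : bilin l W) : linear (tlift f).
Proof. by move=> c u v; rewrite /tlift linearP. Qed.
HB.instance Definition _ l W (f : bilin l W) :=
  GRing.isLinear.Build K (gtens l) W *:%R (tlift f) (tlift_linear f).

Lemma tlift_pure l W (f : bilin l W) (i j : int) (e : l = i + j) a b :
  tlift f (tpure e a b) = f i j e a b.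
Proof. by rewrite /tlift /tpure jlift_pi. Qed.

Lemma gtens_sep l (u v : gtens l) :
  (forall W (f : bilin l W), tlift f u = tlift f v) -> u = v.
Proof. by move=> h; apply: (@jlift_inj K (tens_evals l)) => -[W f]; apply: h. Qed.

Lemma tpure_linl l (i j : int) (e : l = i + j) b : linear (fun a => tpure e a b).
Proof.
move=> c x y; apply: gtens_sep => W f.
by rewrite linearP /= !tlift_pure bl_linl.
Qed.

Lemma tpure_linr l (i j : int) (e : l = i + j) a : linear (tpure e a).
Proof.
move=> c x y; apply: gtens_sep => W f.
by rewrite linearP /= !tlift_pure bl_linr.
Qed.

Lemma tpure_Zl l (i j : int) (e : l = i + j) c a b :
  tpure e (c *: a) b = c *: tpure e a b.
Proof. exact: lin_Z (tpure_linl e b) c a. Qed.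

Lemma tpure_Zr l (i j : int) (e : l = i + j) c a b :
  tpure e a (c *: b) = c *: tpure e a b.
Proof. exact: lin_Z (tpure_linr e a) c b. Qed.

Lemma gtens_ind l (P : gtens l -> Prop) :
  (forall (i j : int) (e : l = i + j) a b, P (tpure e a b)) ->
  P 0 -> (forall u v, P u -> P v -> P (u + v)) ->
  (forall c u, P u -> P (c *: u)) -> forall u, P u.
Proof.
move=> Pp P0 PD PZ u; have [x ->] := jpi_surj u.
elim: x => [i j e a b| |x Px y Py|c x Px]; first exact: Pp.
- by rewrite jpi_zero.
- by rewrite jpi_add; apply: PD.
- by rewrite jpi_scale; apply: PZ.
Qed.

Lemma gtens_ext l (W : lmodType K) (f g : {linear gtens l -> W}) :
  (forall (i j : int) (e : l = i + j) a b, f (tpure e a b) = g (tpure e a b)) ->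
  f =1 g.
Proof.
move=> h; elim/gtens_ind => [i j e a b||u v hu hv|c u hu]; first exact: h.
- by rewrite !linear0.
- by rewrite !linearD hu hv.
- by rewrite !linearZ /= hu.
Qed.

Lemma gtens_lin_ext l (W : lmodType K) (f g : gtens l -> W) :
  linear f -> linear g ->
  (forall (i j : int) (e : l = i + j) a b, f (tpure e a b) = g (tpure e a b)) ->
  forall u, f u = g u.
Proof.
move=> lf lg h.
pose F : {linear gtens l -> W} := HB.pack f (GRing.isLinear.Build K _ _ _ f lf).
pose G : {linear gtens l -> W} := HB.pack g (GRing.isLinear.Build K _ _ _ g lg).
exact: (gtens_ext (f := F) (g := G)).
Qed.
End GradedTensor.

(* When [q], of arity [m], is grafted at slot [a] of [p], slot [j != a] of [p]
   becomes slot [outer_slot a m j] of the composite, and slot [j] of [q]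
   becomes slot [a + j]. *)
Definition outer_slot (a m j : nat) : nat := if (j < a)%N then j else (j + m).-1.

(* [rho] is the permutation [s o_a t] of the inputs of the composite. *)
Definition block_perm n m r (a : 'I_n) (s : 'S_n) (t : 'S_m) (rho : 'S_r) :=
  (forall (j : 'I_n) (u : 'I_r), j != a -> u = outer_slot a m j :> nat ->
     rho u = outer_slot (s a) m (s j) :> nat) /\
  (forall (j : 'I_m) (u : 'I_r), u = (a + j)%N :> nat ->
     rho u = (s a + t j)%N :> nat).

(* Graded symmetric operads, in terms of partial compositions; slots are
   numbered from 0.  [op_comp _ _ a p q] is [p o_a q]; its arity [r] and degree
   [l] are free indices constrained by equations, which avoids transports along
   equalities of arities and degrees.  [op_act s p] is
   [p(x_(s 0), ..., x_(s (n-1)))], a left action for the composition of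
   functions; the product [t * s] of [perm] is "[t] then [s]". *)
Record operad (K : fieldType) := Operad {
  op_space :> nat -> int -> lmodType K;
  op_unit : op_space 1%N 0;
  op_act : forall n i, 'S_n -> op_space n i -> op_space n i;
  op_comp : forall n m r (i j l : int), r.+1 = (n + m)%N -> l = i + j -> 'I_n ->
    op_space n i -> op_space m j -> op_space r l;
  op_act_linear : forall n i (s : 'S_n), linear (@op_act n i s);
  op_act1 : forall n i (p : op_space n i), op_act 1%g p = p;
  op_actM : forall n i (s t : 'S_n) (p : op_space n i),
    op_act s (op_act t p) = op_act (t * s)%g p;
  op_comp_linl : forall n m r (i j l : int) (er : r.+1 = (n + m)%N) (el : l = i + j)
    (a : 'I_n) (q : op_space m j),
    linear (fun p : op_space n i => op_comp er el a p q);
  op_comp_linr : forall n m r (i j l : int) (er : r.+1 = (n + m)%N) (el : l = i + j)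
    (a : 'I_n) (p : op_space n i),
    linear (fun q : op_space m j => op_comp er el a p q);
  op_comp_unitl : forall n i (er : n.+1 = (1 + n)%N) (el : i = 0 + i)
    (a : 'I_1) (p : op_space n i), op_comp er el a op_unit p = p;
  op_comp_unitr : forall n i (er : n.+1 = (n + 1)%N) (el : i = i + 0)
    (a : 'I_n) (p : op_space n i), op_comp er el a p op_unit = p;
  op_comp_seq : forall n m h r s t (i j l x y z : int)
    (e1 : r.+1 = (n + m)%N) (f1 : x = i + j)
    (e2 : t.+1 = (r + h)%N) (f2 : z = x + l)
    (e3 : s.+1 = (m + h)%N) (f3 : y = j + l)
    (e4 : t.+1 = (n + s)%N) (f4 : z = i + y)
    (a : 'I_n) (b : 'I_m) (c : 'I_r)
    (p : op_space n i) (q : op_space m j) (w : op_space h l),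
    c = (a + b)%N :> nat ->
    op_comp e2 f2 c (op_comp e1 f1 a p q) w =
    op_comp e4 f4 a p (op_comp e3 f3 b q w);
  op_comp_par : forall n m h r s t (i j l x y z : int)
    (e1 : r.+1 = (n + m)%N) (f1 : x = i + j)
    (e2 : t.+1 = (r + h)%N) (f2 : z = x + l)
    (e3 : s.+1 = (n + h)%N) (f3 : y = i + l)
    (e4 : t.+1 = (s + m)%N) (f4 : z = y + j)
    (a b : 'I_n) (a' : 'I_r) (b' : 'I_s)
    (p : op_space n i) (q : op_space m j) (w : op_space h l),
    (a < b)%N -> a' = a :> nat -> b'.+1 = (b + h)%N ->
    op_comp e2 f2 a' (op_comp e1 f1 b p q) w =
    (-1) ^ (j * l) *: op_comp e4 f4 b' (op_comp e3 f3 a p w) q;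
  op_comp_equiv : forall n m r (i j l : int) (er : r.+1 = (n + m)%N) (el : l = i + j)
    (a : 'I_n) (s : 'S_n) (t : 'S_m) (rho : 'S_r)
    (p : op_space n i) (q : op_space m j),
    block_perm a s t rho ->
    op_comp er el (s a) (op_act s p) (op_act t q) =
    op_act rho (op_comp er el a p q)
}.
Arguments op_unit {K} o.

Record operad_hom (K : fieldType) (P Q : operad K) := OperadHom {
  hom_fun :> forall n i, {linear P n i -> Q n i};
  hom_unit : hom_fun 1%N 0 (op_unit P) = op_unit Q;
  hom_act : forall n i (s : 'S_n) (p : P n i),
    hom_fun n i (op_act s p) = op_act s (hom_fun n i p);
  hom_comp : forall n m r (i j l : int) (er : r.+1 = (n + m)%N) (el : l = i + j)
    (a : 'I_n) (p : P n i) (q : P m j),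
    hom_fun r l (op_comp er el a p q) =
    op_comp er el a (hom_fun n i p) (hom_fun m j q)
}.

(* Aritywise tensor product, with
   (p (x) q) o_a (p' (x) q') = (-1)^(|q||p'|) (p o_a p') (x) (q o_a q'). *)
Section OperadTensor.
Variables (K : fieldType) (P Q : operad K).

Definition tspace (n : nat) : int -> lmodType K := gtens (P n) (Q n).

Lemma tdeg (i j i' j' x y z : int) : x = i + j -> y = i' + j' -> z = x + y ->
  z = (i + i') + (j + j').
Proof. by move=> -> -> ->; rewrite addrACA. Qed.

Section Comp.
Variables (n m r : nat) (er : r.+1 = (n + m)%N) (a : 'I_n).
Variables (x y z : int) (ez : z = x + y).

Definition tcomp_in (i j : int) (e : x = i + j) (p : P n i) (q : Q n j) :
  bilin (P m) (Q m) y (tspace r z).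
Proof.
refine (@Bilin _ _ _ _ (tspace r z) (fun i' j' (e' : y = i' + j') p' q' =>
  (-1) ^ (j * i') *: tpure (tdeg e e' ez) (op_comp er erefl a p p')
    (op_comp er erefl a q q')) _ _).
- abstract (by move=> i' j' e' q' c u v /=;
    rewrite op_comp_linr tpure_linl scalerDr !scalerA [c * _]mulrC).
- abstract (by move=> i' j' e' p' c u v /=;
    rewrite op_comp_linr tpure_linr scalerDr !scalerA [c * _]mulrC).
Defined.

Definition tcomp_out (v : tspace m y) : bilin (P n) (Q n) x (tspace r z).
Proof.
refine (@Bilin _ _ _ _ (tspace r z) (fun i j (e : x = i + j) p q =>
  tlift (tcomp_in e p q) v) _ _).
- abstract (move=> i j e q c p p' /=; move: v;
    refine (gtens_ext (f := tlift (tcomp_in e (c *: p + p') q))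
      (g := c \*: tlift (tcomp_in e p q) \+ tlift (tcomp_in e p' q)) _) =>
      i' j' e' u v /=;
    by rewrite !tlift_pure /= op_comp_linl tpure_linl
      scalerDr !scalerA [c * _]mulrC).
- abstract (move=> i j e p c q q' /=; move: v;
    refine (gtens_ext (f := tlift (tcomp_in e p (c *: q + q')))
      (g := c \*: tlift (tcomp_in e p q) \+ tlift (tcomp_in e p q')) _) =>
      i' j' e' u v /=;
    by rewrite !tlift_pure /= op_comp_linl tpure_linr
      scalerDr !scalerA [c * _]mulrC).
Defined.

Definition tcomp (u : tspace n x) (v : tspace m y) : tspace r z :=
  tlift (tcomp_out v) u.
End Comp.

Definition tact_bilin n x (s : 'S_n) : bilin (P n) (Q n) x (tspace n x).
Proof.
refine (@Bilin _ _ _ _ (tspace n x) (fun i j (e : x = i + j) p q =>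
  tpure e (op_act s p) (op_act s q)) _ _).
- abstract (by move=> i j e q c u v /=; rewrite op_act_linear tpure_linl).
- abstract (by move=> i j e p c u v /=; rewrite op_act_linear tpure_linr).
Defined.

Definition tact n x (s : 'S_n) : tspace n x -> tspace n x :=
  tlift (tact_bilin x s).

Definition tunit : tspace 1%N 0 :=
  tpure (esym (addr0 0)) (op_unit P) (op_unit Q).

Lemma tcomp_linl n m r (x y z : int) (er : r.+1 = (n + m)%N) (ez : z = x + y)
  (a : 'I_n) (v : tspace m y) : linear (fun u => tcomp er a ez u v).
Proof. by move=> c u u'; rewrite /tcomp linearP. Qed.

Lemma tcomp_pure n m r (x y z : int) (er : r.+1 = (n + m)%N) (ez : z = x + y)
    (a : 'I_n) (i j : int) (e : x = i + j) p q (i' j' : int)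
    (e' : y = i' + j') p' q' (i'' j'' : int)
    (e'' : z = i'' + j'') (ei : i'' = i + i') (ej : j'' = j + j') :
  tcomp er a ez (tpure e p q) (tpure e' p' q') =
  (-1) ^ (j * i') *: tpure e'' (op_comp er ei a p p') (op_comp er ej a q q')
    :> tspace r z.
Proof.
subst i'' j''; rewrite /tcomp !tlift_pure /= tlift_pure /=.
by rewrite (eq_irrelevance (tdeg e e' ez) e'').
Qed.

Lemma tcomp_linr n m r (x y z : int) (er : r.+1 = (n + m)%N) (ez : z = x + y)
  (a : 'I_n) (u : tspace n x) : linear (fun v => tcomp er a ez u v).
Proof.
move=> c v v'; rewrite /tcomp; move: u.
refine (gtens_ext (f := tlift (tcomp_out er a ez (c *: v + v')))
      (g := c \*: tlift (tcomp_out er a ez v) \+ tlift (tcomp_out er a ez v')) _) => i j e p q.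
by rewrite /= !tlift_pure /= linearP.
Qed.

Lemma tact_linear n x (s : 'S_n) : linear (@tact n x s).
Proof. by move=> c u v; rewrite /tact linearP. Qed.

Lemma tact_pure n x (s : 'S_n) (i j : int) (e : x = i + j) p q :
  tact s (tpure e p q) = tpure e (op_act s p) (op_act s q).
Proof. by rewrite /tact tlift_pure. Qed.
End OperadTensor.
Arguments tcomp_pure {K P Q n m r x y z} er ez a {i j} e p q {i' j'}
  e' p' q' {i'' j''} e'' ei ej.

Section OperadTensorAxioms.
Variables (K : fieldType) (P Q : operad K).
Local Notation T := (tspace P Q).

Let tact1 n x (u : T n x) : tact 1%g u = u.
Proof.
move: u; apply: gtens_lin_ext => [|//|i j e p q]; first exact: tact_linear.
by rewrite tact_pure !op_act1.
Qed.

Let tactM n x (s t : 'S_n) (u : T n x) : tact s (tact t u) = tact (t * s)%g u.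
Proof.
move: u; apply: gtens_lin_ext => [||i j e p q].
- by apply: lin_comp; apply: tact_linear.
- exact: tact_linear.
- by rewrite !tact_pure !op_actM.
Qed.

Let tcomp_unitl n x (er : n.+1 = (1 + n)%N) (ex : x = 0 + x) (a : 'I_1)
  (u : T n x) : tcomp er a ex (tunit P Q) u = u.
Proof.
move: u; apply: gtens_lin_ext => [|//|i j e p q]; first exact: tcomp_linr.
rewrite (tcomp_pure _ _ _ _ _ _ _ _ _ e (esym (add0r i)) (esym (add0r j))).
by rewrite !op_comp_unitl mul0r expr0z scale1r.
Qed.

Let tcomp_unitr n x (er : n.+1 = (n + 1)%N) (ex : x = x + 0) (a : 'I_n)
  (u : T n x) : tcomp er a ex u (tunit P Q) = u.
Proof.
move: u; apply: gtens_lin_ext => [|//|i j e p q]; first exact: tcomp_linl.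
rewrite (tcomp_pure _ _ _ _ _ _ _ _ _ e (esym (addr0 i)) (esym (addr0 j))).
by rewrite !op_comp_unitr mulr0 expr0z scale1r.
Qed.

Let signM (a b : int) : (-1) ^ a * (-1) ^ b = (-1) ^ (a + b) :> K.
Proof. by rewrite expfzDr // oppr_eq0 oner_eq0. Qed.

Let sign2 (a b c : int) : a = b + c + c -> (-1) ^ a = (-1) ^ b :> K.
Proof.
move=> ->; rewrite -addrA -signM -[X in _ * X]signM -expfzMl.
by rewrite mulrNN mulr1 exp1rz mulr1.
Qed.

Let tcomp_seq n m h r s t (i j l x y z : int)
    (e1 : r.+1 = (n + m)%N) (f1 : x = i + j)
    (e2 : t.+1 = (r + h)%N) (f2 : z = x + l)
    (e3 : s.+1 = (m + h)%N) (f3 : y = j + l)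
    (e4 : t.+1 = (n + s)%N) (f4 : z = i + y)
    (a : 'I_n) (b : 'I_m) (c : 'I_r)
    (u : T n i) (v : T m j) (w : T h l) :
  c = (a + b)%N :> nat ->
  tcomp e2 c f2 (tcomp e1 a f1 u v) w = tcomp e4 a f4 u (tcomp e3 b f3 v w).
Proof.
move=> ec; move: u; apply: gtens_lin_ext => [||i1 i2 ei p1 p2].
- apply: (lin_comp (f := fun u => tcomp e2 c f2 u w)); exact: tcomp_linl.
- exact: tcomp_linl.
move: v; apply: gtens_lin_ext => [||j1 j2 ej q1 q2].
- apply: (lin_comp (f := fun u => tcomp e2 c f2 u w)); [exact: tcomp_linl|exact: tcomp_linr].
- apply: (lin_comp (f := fun u => tcomp e4 a f4 _ u)); [exact: tcomp_linr|exact: tcomp_linl].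
move: w; apply: gtens_lin_ext => [||l1 l2 el w1 w2].
- exact: tcomp_linr.
- apply: (lin_comp (f := fun u => tcomp e4 a f4 _ u)); exact: tcomp_linr.
have ex : x = (i1 + j1) + (i2 + j2) by rewrite f1 ei ej addrACA.
have ey : y = (j1 + l1) + (j2 + l2) by rewrite f3 ej el addrACA.
have ez : z = (i1 + j1 + l1) + (i2 + j2 + l2).
  by rewrite f2 ex el addrACA.
rewrite (tcomp_pure _ _ _ _ _ _ _ _ _ ex erefl erefl).
rewrite (tcomp_pure _ _ _ _ _ _ _ _ _ ey erefl erefl).
have tZl k u v : tcomp e2 c f2 (k *: u : T _ _) v = k *: tcomp e2 c f2 u v.
  exact: (lin_Z (tcomp_linl e2 f2 c v)).
have tZr k u v : tcomp e4 a f4 u (k *: v : T _ _) = k *: tcomp e4 a f4 u v.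
  exact: (lin_Z (tcomp_linr e4 f4 a u)).
rewrite tZl tZr.
rewrite (tcomp_pure _ _ _ _ _ _ _ _ _ ez erefl erefl).
rewrite (tcomp_pure _ _ _ _ _ _ _ _ _ ez (esym (addrA _ _ _)) (esym (addrA _ _ _))).
rewrite !(op_comp_seq _ _ _ _ e3 erefl e4 (esym (addrA _ _ _)) _ _ _ ec) !scalerA !signM.
congr (_ ^ _ *: _); ring.
Qed.

Let tcomp_par n m h r s t (i j l x y z : int)
    (e1 : r.+1 = (n + m)%N) (f1 : x = i + j)
    (e2 : t.+1 = (r + h)%N) (f2 : z = x + l)
    (e3 : s.+1 = (n + h)%N) (f3 : y = i + l)
    (e4 : t.+1 = (s + m)%N) (f4 : z = y + j)
    (a b : 'I_n) (a' : 'I_r) (b' : 'I_s)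
    (u : T n i) (v : T m j) (w : T h l) :
  (a < b)%N -> a' = a :> nat -> b'.+1 = (b + h)%N ->
  tcomp e2 a' f2 (tcomp e1 b f1 u v) w =
  (-1) ^ (j * l) *: tcomp e4 b' f4 (tcomp e3 a f3 u w) v.
Proof.
move=> ab ea eb; move: u; apply: gtens_lin_ext => [||i1 i2 ei p1 p2].
- apply: (lin_comp (f := fun u => tcomp e2 a' f2 u w)); exact: tcomp_linl.
- apply/lin_scale/(lin_comp (f := fun u => tcomp e4 b' f4 u v)); exact: tcomp_linl.
move: v; apply: gtens_lin_ext => [||j1 j2 ej q1 q2].
- apply: (lin_comp (f := fun u => tcomp e2 a' f2 u w)); [exact: tcomp_linl|exact: tcomp_linr].
- apply/lin_scale; exact: tcomp_linr.
move: w; apply: gtens_lin_ext => [||l1 l2 el w1 w2].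
- exact: tcomp_linr.
- apply/lin_scale/(lin_comp (f := fun u => tcomp e4 b' f4 u _)); [exact: tcomp_linl|exact: tcomp_linr].
have ex : x = (i1 + j1) + (i2 + j2) by rewrite f1 ei ej addrACA.
have ey : y = (i1 + l1) + (i2 + l2) by rewrite f3 ei el addrACA.
have ez : z = (i1 + j1 + l1) + (i2 + j2 + l2).
  by rewrite f2 ex el addrACA.
rewrite (tcomp_pure _ _ _ _ _ _ _ _ _ ex erefl erefl).
rewrite (tcomp_pure _ _ _ _ _ _ _ _ _ ey erefl erefl).
have tZl k u v : tcomp e2 a' f2 (k *: u : T _ _) v = k *: tcomp e2 a' f2 u v.
  exact: (lin_Z (tcomp_linl e2 f2 a' v)).
have tZl' k u v : tcomp e4 b' f4 (k *: u : T _ _) v = k *: tcomp e4 b' f4 u v.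
  exact: (lin_Z (tcomp_linl e4 f4 b' v)).
rewrite tZl tZl'.
rewrite (tcomp_pure _ _ _ _ _ _ _ _ _ ez erefl erefl).
rewrite (tcomp_pure _ _ _ _ _ _ _ _ _ ez (addrAC _ _ _) (addrAC _ _ _)).
rewrite !(op_comp_par _ _ _ _ e3 erefl e4 (addrAC _ _ _) _ _ _ ab ea eb).
rewrite tpure_Zl tpure_Zr !scalerA !signM; congr (_ *: _).
rewrite ej el; apply: (@sign2 _ _ (- (j1 * l2))); ring.
Qed.

Let tcomp_equiv n m r (i j l : int) (er : r.+1 = (n + m)%N) (el : l = i + j)
    (a : 'I_n) (s : 'S_n) (t : 'S_m) (rho : 'S_r) (u : T n i) (v : T m j) :
  block_perm a s t rho ->
  tcomp er (s a) el (tact s u) (tact t v) = tact rho (tcomp er a el u v).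
Proof.
move=> hb; move: u; apply: gtens_lin_ext => [||i1 i2 ei p1 p2].
- apply: (lin_comp (f := fun u => tcomp er (s a) el u _)); [exact: tcomp_linl|exact: tact_linear].
- apply: lin_comp; [exact: tact_linear|exact: tcomp_linl].
move: v; apply: gtens_lin_ext => [||j1 j2 ej q1 q2].
- apply: (lin_comp (f := fun v => tcomp er (s a) el _ v)); [exact: tcomp_linr|exact: tact_linear].
- apply: lin_comp; [exact: tact_linear|exact: tcomp_linr].
have ex : l = (i1 + j1) + (i2 + j2) by rewrite el ei ej addrACA.
rewrite !tact_pure !(tcomp_pure _ _ _ _ _ _ _ _ _ ex erefl erefl).
rewrite !(op_comp_equiv _ _ _ _ hb) -tact_pure.
exact/esym/(lin_Z (@tact_linear _ _ _ _ _ rho)).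
Qed.

Definition op_tensor : operad K := Operad (op_space := T)
  (op_unit := tunit P Q) (op_act := @tact K P Q)
  (op_comp := fun n m r i j l er el a u v => tcomp er a el u v)
  (@tact_linear K P Q) tact1 tactM (@tcomp_linl K P Q) (@tcomp_linr K P Q)
  tcomp_unitl tcomp_unitr tcomp_seq tcomp_par tcomp_equiv.
End OperadTensorAxioms.

Section TensorMaps.
Variables (K : fieldType).

Definition tmap_bilin (A B A' B' : int -> lmodType K)
  (f : forall i, {linear A i -> A' i}) (g : forall j, {linear B j -> B' j}) l :
  bilin A B l (gtens A' B' l).
Proof.
refine (@Bilin _ _ _ _ _ (fun i j (e : l = i + j) a b =>
  tpure e (f i a) (g j b)) _ _).
- abstract (by move=> i j e b c u v /=; rewrite linearP tpure_linl).
- abstract (by move=> i j e a c u v /=; rewrite linearP tpure_linr).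
Defined.

(* No sign appears, since [f] and [g] have degree 0. *)
Definition tmap A B A' B' f g l : gtens A B l -> gtens A' B' l :=
  tlift (@tmap_bilin A B A' B' f g l).

Variables (A B C : int -> lmodType K).

Lemma tassoc_deg (l m h i j : int) : l = m + h -> m = i + j -> l = i + (j + h).
Proof. by move=> -> ->; rewrite addrA. Qed.

Definition tassoc_in l (m h : int) (e : l = m + h) (c : C h) :
  bilin A B m (gtens A (gtens B C) l).
Proof.
refine (@Bilin _ _ _ _ _ (fun i j (e' : m = i + j) a b =>
  tpure (tassoc_deg e e') a (tpure erefl b c)) _ _).
- abstract (by move=> i j e' b k u v /=; rewrite tpure_linl).
- abstract (by move=> i j e' a k u v /=; rewrite tpure_linl tpure_linr).
Defined.

Definition tassoc_out l : bilin (gtens A B) C l (gtens A (gtens B C) l).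
Proof.
refine (@Bilin _ _ _ _ _ (fun m h (e : l = m + h) (u : gtens A B m) (c : C h) =>
  tlift (tassoc_in e c) u) _ _).
- abstract (by move=> m h e c k u v /=; rewrite linearP).
- abstract (move=> m h e u k c c' /=; move: u;
    refine (gtens_ext (f := tlift (tassoc_in e (k *: c + c')))
      (g := k \*: tlift (tassoc_in e c) \+ tlift (tassoc_in e c')) _) =>
      i j e' a b /=;
    by rewrite !tlift_pure /= !tpure_linr).
Defined.

(* The associator (a (x) b) (x) c |-> a (x) (b (x) c). *)
Definition tassoc l : gtens (gtens A B) C l -> gtens A (gtens B C) l :=
  tlift (tassoc_out l).
End TensorMaps.

Definition coassociative (K : fieldType) (P : operad K)
    (D : operad_hom P (op_tensor P P)) : Prop :=
  forall n i (x : P n i),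
    tassoc (tmap (fun i => D n i) (fun i => idfun) (D n i x)) =
    tmap (fun i => idfun) (fun i => D n i) (D n i x).

Record hopf_structure (K : fieldType) (P : operad K) := HopfStructure {
  hopf_delta :> operad_hom P (op_tensor P P);
  hopf_coassoc : coassociative hopf_delta
}.

(* [op_prod mu j] is mu^{o j}, the product of [j + 1] arguments. *)
Fixpoint op_prod (K : fieldType) (P : operad K) (mu : P 2%N 0) (j : nat) :
    P j.+1 0 :=
  match j with
  | 0%N => op_unit P
  | j'.+1 => op_comp (erefl : j'.+3 = (2 + j'.+1)%N) (esym (addr0 0)) ord0
               mu (op_prod mu j')
  end.

Section Pois.
Variables (K : fieldType) (k : nat) (d : int).

Definition nu_deg : int := 1 - k%:Z * d.

(* S_(k+1) x S_k inside S_(2k+1).  Since [h * s] in [perm] is "[h] then [s]",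
   the cosets s (S_(k+1) x S_k) are the right cosets in the sense of
   [rcosets]. *)
Definition young_subgroup : {set 'S_(k + k).+1} :=
  [set h : 'S_(k + k).+1 | [forall j, (h j <= k)%N == (j <= k)%N]].

Definition even_transversal (X : {set 'S_(k + k).+1}) : bool :=
  is_transversal X (rcosets young_subgroup [set: 'S_(k + k).+1])
    [set: 'S_(k + k).+1]
  && [forall s in X, ~~ odd_perm s].

Lemma jacobi_arity : (k + k).+2 = (k.+1 + k.+1)%N.
Proof. by rewrite addSn addnS. Qed.

Lemma leibniz_arity : k.+3 = (k.+1 + 2)%N.
Proof. by rewrite addn2. Qed.

Record pois_relations (P : operad K) (mu : P 2%N 0) (nu : P k.+1 nu_deg) : Prop :=
  PoisRelations {
  pois_mu_sym : forall s : 'S_2, op_act s mu = mu;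
  pois_mu_assoc :
    op_comp (erefl : 4%N = (2 + 2)%N) (esym (addr0 0)) ord0 mu mu =
    op_comp (erefl : 4%N = (2 + 2)%N) (esym (addr0 0)) ord_max mu mu;
  pois_nu_sym : forall s : 'S_k.+1, op_act s nu = ((-1) ^+ s) ^ d *: nu;
  pois_jacobi : forall X : {set 'S_(k + k).+1}, even_transversal X ->
    \sum_(s in X) op_act s
      (op_comp jacobi_arity (erefl (nu_deg + nu_deg)) ord0 nu nu) = 0;
  pois_leibniz :
    let mu_nu := op_comp (erefl : k.+3 = (2 + k.+1)%N) (esym (add0r nu_deg))
                   ord0 mu nu in
    op_comp leibniz_arity (esym (addr0 nu_deg)) ord_max nu mu =
    op_act (tperm (inord k) ord_max) mu_nu + mu_nu
}.

Record pois_model := PoisModel {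
  pm_operad :> operad K;
  pm_mu : pm_operad 2%N 0;
  pm_nu : pm_operad k.+1 nu_deg;
  pm_relations : pois_relations pm_mu pm_nu
}.

(* Formal operadic expressions in the generators; Pois^k_d is their quotient by
   the identities that hold in all operads with operations mu and nu subject to
   the relations, i.e. that follow from the operad axioms and the relations. *)
Inductive pexpr : nat -> int -> Type :=
| Emu : pexpr 2%N 0
| Enu : pexpr k.+1 nu_deg
| Eunit : pexpr 1%N 0
| Ezero n i : pexpr n i
| Eadd n i of pexpr n i & pexpr n i : pexpr n i
| Escale n i of K & pexpr n i : pexpr n i
| Eact n i of 'S_n & pexpr n i : pexpr n i
| Ecomp n m r i j l of r.+1 = (n + m)%N & l = i + j & 'I_n &
    pexpr n i & pexpr m j : pexpr r l.

Fixpoint peval (M : pois_model) n i (x : pexpr n i) : M n i :=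
  match x in pexpr n i return M n i with
  | Emu => pm_mu M
  | Enu => pm_nu M
  | Eunit => op_unit M
  | Ezero _ _ => 0
  | Eadd _ _ x y => peval M x + peval M y
  | Escale _ _ c x => c *: peval M x
  | Eact _ _ s x => op_act s (peval M x)
  | Ecomp _ _ _ _ _ _ er el a x y => op_comp er el a (peval M x) (peval M y)
  end.

Definition pois_evals n i : evaluations K :=
  @Evaluations K (pexpr n i) pois_model (fun M => M n i)
    (fun M => @peval M n i) (Ezero n i) (@Eadd n i) (@Escale n i)
    (fun=> erefl) (fun _ _ _ => erefl) (fun _ _ _ => erefl).

Definition pois_space n i : lmodType K := jquot (pois_evals n i).
Definition pois_pi n i (x : pexpr n i) : pois_space n i :=
  @jpi K (pois_evals n i) x.
Definition pois_lift (M : pois_model) n i : pois_space n i -> M n i :=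
  @jlift K (pois_evals n i) M.

Lemma pois_lift_linear M n i : linear (@pois_lift M n i).
Proof. exact: jlift_linear. Qed.
HB.instance Definition _ (M : pois_model) n i := GRing.isLinear.Build K (pois_space n i)
  (M n i) *:%R (@pois_lift M n i) (@pois_lift_linear M n i).

Lemma pois_lift_pi M n i (x : pexpr n i) : pois_lift M (pois_pi x) = peval M x.
Proof. exact: (@jlift_pi K (pois_evals n i)). Qed.
Lemma pois_ext n i (u v : pois_space n i) :
  (forall M, pois_lift M u = pois_lift M v) -> u = v.
Proof. exact: (@jlift_inj K (pois_evals n i)). Qed.
Lemma pois_pi_surj n i (u : pois_space n i) : exists x, u = pois_pi x.
Proof. exact: (@jpi_surj K (pois_evals n i)). Qed.

Definition pois_act n i (s : 'S_n) (u : pois_space n i) : pois_space n i :=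
  pois_pi (Eact s (repr u)).
Definition pois_comp n m r (i j l : int) (er : r.+1 = (n + m)%N)
  (el : l = i + j) (a : 'I_n) (u : pois_space n i) (v : pois_space m j) :
  pois_space r l := pois_pi (Ecomp er el a (repr u) (repr v)).

Lemma pois_lift_act M n i (s : 'S_n) (u : pois_space n i) :
  pois_lift M (pois_act s u) = op_act s (pois_lift M u).
Proof. by rewrite pois_lift_pi. Qed.
Lemma pois_lift_comp M n m r (i j l : int) (er : r.+1 = (n + m)%N)
    (el : l = i + j) (a : 'I_n) (u : pois_space n i) (v : pois_space m j) :
  pois_lift M (pois_comp er el a u v) =
  op_comp er el a (pois_lift M u) (pois_lift M v).
Proof. by rewrite pois_lift_pi. Qed.
Lemma pois_lift_unit M : pois_lift M (pois_pi Eunit) = op_unit M.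
Proof. exact: pois_lift_pi. Qed.

Definition Pois : operad K.
Proof.
refine (@Operad K pois_space (pois_pi Eunit) pois_act pois_comp
  _ _ _ _ _ _ _ _ _ _).
- abstract (by move=> n i s c u v; apply: pois_ext => M;
    rewrite linearP /= !pois_lift_act linearP /= op_act_linear).
- abstract (by move=> n i p; apply: pois_ext => M;
    rewrite pois_lift_act op_act1).
- abstract (by move=> n i s t p; apply: pois_ext => M;
    rewrite !pois_lift_act op_actM).
- abstract (by move=> n m r i j l er el a q c u v; apply: pois_ext => M;
    rewrite linearP /= !pois_lift_comp linearP /= op_comp_linl).
- abstract (by move=> n m r i j l er el a q c u v; apply: pois_ext => M;
    rewrite linearP /= !pois_lift_comp linearP /= op_comp_linr).
- abstract (by move=> n i er el a p; apply: pois_ext => M;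
    rewrite pois_lift_comp pois_lift_unit op_comp_unitl).
- abstract (by move=> n i er el a p; apply: pois_ext => M;
    rewrite pois_lift_comp pois_lift_unit op_comp_unitr).
- abstract (move=> n m h r s t i j l x y z e1 f1 e2 f2 e3 f3 e4 f4 a b c p q w
    ec; apply: pois_ext => M;
    by rewrite !pois_lift_comp (op_comp_seq _ _ _ _ e3 f3 e4 f4 _ _ _ ec)).
- abstract (move=> n m h r s t i j l x y z e1 f1 e2 f2 e3 f3 e4 f4 a b a' b'
    p q w ab ea eb; apply: pois_ext => M;
    by rewrite linearZ /= !pois_lift_comp
      (op_comp_par _ _ _ _ e3 f3 e4 f4 _ _ _ ab ea eb)).
- abstract (move=> n m r i j l er el a s t rho p q hb; apply: pois_ext => M;
    by rewrite pois_lift_act !pois_lift_comp !pois_lift_act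
      (op_comp_equiv _ _ _ _ hb)).
Defined.

Definition pois_mu : Pois 2%N 0 := pois_pi Emu.
Definition pois_nu : Pois k.+1 nu_deg := pois_pi Enu.

Lemma Pois_relations : pois_relations pois_mu pois_nu.
Proof.
split=> [s||s|X hX|mu_nu]; apply: pois_ext => M.
- by rewrite pois_lift_act pois_lift_pi (pois_mu_sym (pm_relations M)).
- by rewrite !pois_lift_comp pois_lift_pi (pois_mu_assoc (pm_relations M)).
- by rewrite linearZ /= pois_lift_act pois_lift_pi (pois_nu_sym (pm_relations M)).
- rewrite linear0 -[RHS](pois_jacobi (pm_relations M) hX) linear_sum /=.
  by apply: eq_bigr => s _; rewrite pois_lift_act pois_lift_comp pois_lift_pi.
- rewrite linearD /= pois_lift_act !pois_lift_comp !pois_lift_pi.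
  exact: (pois_leibniz (pm_relations M)).
Qed.

Definition pois_hom (M : pois_model) : operad_hom Pois M :=
  @OperadHom K Pois M (fun n i => @pois_lift M n i) (pois_lift_unit M)
    (@pois_lift_act M) (@pois_lift_comp M).

Lemma pois_hom_mu M : pois_hom M _ _ pois_mu = pm_mu M.
Proof. exact: pois_lift_pi. Qed.
Lemma pois_hom_nu M : pois_hom M _ _ pois_nu = pm_nu M.
Proof. exact: pois_lift_pi. Qed.
End Pois.

(* mu |-> mu (x) mu  and  nu |-> mu^{o k} (x) nu + nu (x) mu^{o k}. *)
Definition extends_generators (K : fieldType) (k : nat) (d : int)
    (D : operad_hom (Pois K k d) (op_tensor (Pois K k d) (Pois K k d))) : Prop :=
  let mu := pois_mu K k d in
  let nu := pois_nu K k d in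
  D 2%N 0 mu = tpure (esym (addr0 0)) mu mu /\
  D k.+1 (nu_deg k d) nu =
    tpure (esym (add0r (nu_deg k d))) (op_prod mu k) nu +
    tpure (esym (addr0 (nu_deg k d))) nu (op_prod mu k).

(* Main.v *)
(* Pois is the initial operad with operations mu, nu satisfying the relations, so
   it suffices to check the relations for mu (x) mu and M (x) nu + nu (x) M in
   Pois (x) Pois, where M = mu^{o k}; coassociativity and uniqueness then follow
   by comparing operad morphisms on generators.  Only the Jacobi identity is not
   immediate.  It expands into two Jacobi identities of Pois, multiplied by
   M o M on one side, and the cross terms (M o nu) (x) (nu o M) and
   (nu o M) (x) (M o nu).  By Leibniz, the latter are sums of terms in which two
   blocks of k + 1 inputs meet in exactly one input; exchanging the two blocks
   swaps the two families, with total sign (-1)^(1 - k d) (-1)^(k d) = -1. *)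
From HB Require Import structures.
Require Import Defs.
From mathcomp Require Import all_boot all_order all_algebra all_fingroup.
From mathcomp Require Import ring zify.

Set Implicit Arguments.
Unset Strict Implicit.
Unset Printing Implicit Defensive.

Import GRing.Theory.
Local Open Scope ring_scope.

(** * Linearity and morphisms of operads *)

Section LinearOperations.
Variables (K : fieldType) (U V : lmodType K) (f : U -> V).
Hypothesis lf : linear f.

Lemma lin_D u v : f (u + v) = f u + f v.
Proof. by have := lf 1 u v; rewrite !scale1r. Qed.

Lemma lin_0 : f 0 = 0.
Proof. by rewrite -(scale0r 0) lin_Z // scale0r. Qed.

Lemma lin_sum I (r : seq I) (A : pred I) (F : I -> U) :
  f (\sum_(i <- r | A i) F i) = \sum_(i <- r | A i) f (F i).
Proof. by elim/big_rec2: _ => [|i u v _ <-]; rewrite ?lin_0 ?lin_D. Qed.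
End LinearOperations.

Section OperadLinearity.
Variables (K : fieldType) (P : operad K).

Section Act.
Variables (n : nat) (i : int) (s : 'S_n).
Implicit Types p q : P n i.
Lemma op_act0 : op_act s (0 : P n i) = 0.
Proof. exact/lin_0/op_act_linear. Qed.
Lemma op_actD p q : op_act s (p + q) = op_act s p + op_act s q.
Proof. exact/lin_D/op_act_linear. Qed.
Lemma op_actZ c p : op_act s (c *: p) = c *: op_act s p.
Proof. exact/lin_Z/op_act_linear. Qed.
Lemma op_act_sum I (r : seq I) (A : pred I) (F : I -> P n i) :
  op_act s (\sum_(j <- r | A j) F j) = \sum_(j <- r | A j) op_act s (F j).
Proof. exact (lin_sum (@op_act_linear K P n i s) r A F). Qed.
End Act.

Section Comp.
Variables (n m r : nat) (i j l : int) (er : r.+1 = (n + m)%N) (el : l = i + j).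
Variable a : 'I_n.
Implicit Types (p : P n i) (q : P m j).
Local Notation comp := (op_comp er el a).
Lemma op_comp0l q : comp (0 : P n i) q = 0.
Proof. exact: lin_0 (op_comp_linl er el a q). Qed.
Lemma op_comp0r p : comp p (0 : P m j) = 0.
Proof. exact: lin_0 (op_comp_linr er el a p). Qed.
Lemma op_compDl p p' q : comp (p + p') q = comp p q + comp p' q.
Proof. exact: lin_D (op_comp_linl er el a q) p p'. Qed.
Lemma op_compDr p q q' : comp p (q + q') = comp p q + comp p q'.
Proof. exact: lin_D (op_comp_linr er el a p) q q'. Qed.
Lemma op_compZl c p q : comp (c *: p) q = c *: comp p q.
Proof. exact: lin_Z (op_comp_linl er el a q) c p. Qed.
Lemma op_compZr c p q : comp p (c *: q) = c *: comp p q.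
Proof. exact: lin_Z (op_comp_linr er el a p) c q. Qed.
Lemma op_comp_sumr I (s : seq I) (A : pred I) p (F : I -> P m j) :
  comp p (\sum_(x <- s | A x) F x) = \sum_(x <- s | A x) comp p (F x).
Proof. exact (lin_sum (op_comp_linr er el a p) s A F). Qed.
End Comp.
End OperadLinearity.

Section TensorLinearity.
Variables (K : fieldType) (A B : int -> lmodType K).
Variables (l i j : int) (e : l = i + j).
Local Notation tp := (@tpure K A B l i j e).
Lemma tpure0l b : tp 0 b = 0.
Proof. exact: lin_0 (tpure_linl e b). Qed.
Lemma tpure0r a : tp a 0 = 0.
Proof. exact: lin_0 (tpure_linr e a). Qed.
Lemma tpureDl a a' b : tp (a + a') b = tp a b + tp a' b.
Proof. exact: lin_D (tpure_linl e b) a a'. Qed.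
Lemma tpureDr a b b' : tp a (b + b') = tp a b + tp a b'.
Proof. exact: lin_D (tpure_linr e a) b b'. Qed.
Lemma tpure_suml I (s : seq I) (D : pred I) (F : I -> A i) b :
  tp (\sum_(x <- s | D x) F x) b = \sum_(x <- s | D x) tp (F x) b.
Proof. exact (lin_sum (tpure_linl e b) s D F). Qed.
Lemma tpure_sumr I (s : seq I) (D : pred I) a (F : I -> B j) :
  tp a (\sum_(x <- s | D x) F x) = \sum_(x <- s | D x) tp a (F x).
Proof. exact (lin_sum (tpure_linr e a) s D F). Qed.
End TensorLinearity.

Section OperadTensorPure.
Variables (K : fieldType) (P Q : operad K).

Lemma op_tensor_act n x (s : 'S_n) (i j : int) (e : x = i + j) p q :
  op_act s (tpure e p q : op_tensor P Q n x) = tpure e (op_act s p) (op_act s q).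
Proof. exact: tact_pure. Qed.

Lemma op_tensor_comp n m r (x y z : int) (er : r.+1 = (n + m)%N) (ez : z = x + y)
    (a : 'I_n) (i j : int) (e : x = i + j) p q (i' j' : int)
    (e' : y = i' + j') p' q' (i'' j'' : int)
    (e'' : z = i'' + j'') (ei : i'' = i + i') (ej : j'' = j + j') :
  op_comp er ez a (tpure e p q : op_tensor P Q n x)
    (tpure e' p' q' : op_tensor P Q m y) =
  (-1) ^ (j * i') *: tpure e'' (op_comp er ei a p p') (op_comp er ej a q q').
Proof. exact: tcomp_pure. Qed.
End OperadTensorPure.

(** * Tensor products and composites of operad morphisms *)

Section HomTensor.
Variables (K : fieldType) (P Q P' Q' : operad K).
Variables (f : operad_hom P P') (g : operad_hom Q Q').

Definition htmap n i : gtens (P n) (Q n) i -> gtens (P' n) (Q' n) i :=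
  tmap (f n) (g n) (l := i).

Lemma htmap_linear n i : linear (@htmap n i).
Proof. exact: tlift_linear. Qed.

Lemma htmap0 n i : @htmap n i 0 = 0.
Proof. exact: lin_0 (@htmap_linear n i). Qed.
Lemma htmapD n i u v : @htmap n i (u + v) = htmap u + htmap v.
Proof. exact: lin_D (@htmap_linear n i) u v. Qed.
Lemma htmapZ n i c u : @htmap n i (c *: u) = c *: htmap u.
Proof. exact: lin_Z (@htmap_linear n i) c u. Qed.
HB.instance Definition _ n i := GRing.isLinear.Build K (gtens (P n) (Q n) i)
  (gtens (P' n) (Q' n) i) *:%R (@htmap n i) (@htmap_linear n i).

Lemma htmap_pure n l (i j : int) (e : l = i + j) p q :
  htmap (tpure e p q) = tpure e (f n i p) (g n j q).
Proof. exact: tlift_pure. Qed.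

Lemma htmap_unit :
  htmap (op_unit (op_tensor P Q)) = op_unit (op_tensor P' Q').
Proof. by rewrite htmap_pure !hom_unit. Qed.

Lemma htmap_act n i (s : 'S_n) (u : op_tensor P Q n i) :
  htmap (op_act s u) = op_act s (htmap u : op_tensor P' Q' n i).
Proof.
elim/gtens_ind: u => [i1 i2 e p q||u v hu hv|c u hu].
- by rewrite op_tensor_act !htmap_pure op_tensor_act !hom_act.
- by rewrite op_act0 htmap0 op_act0.
- by rewrite op_actD !htmapD op_actD hu hv.
- by rewrite op_actZ !htmapZ op_actZ hu.
Qed.

Lemma htmap_comp n m r (i j l : int) (er : r.+1 = (n + m)%N) (el : l = i + j)
    (a : 'I_n) (u : op_tensor P Q n i) (v : op_tensor P Q m j) :
  htmap (op_comp er el a u v) =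
  op_comp er el a (htmap u : op_tensor P' Q' n i) (htmap v : op_tensor P' Q' m j).
Proof.
elim/gtens_ind: u => [i1 i2 ei p q||u w hu hw|c u hu].
- elim/gtens_ind: v => [j1 j2 ej p' q'||u w hu hw|c u hu].
  + have e : l = (i1 + j1) + (i2 + j2) by rewrite el ei ej addrACA.
    rewrite !htmap_pure !(op_tensor_comp _ _ _ _ _ _ _ _ _ e erefl erefl).
    by rewrite htmapZ htmap_pure !hom_comp.
  + by rewrite !(op_comp0r, htmap0).
  + by rewrite op_compDr !htmapD op_compDr hu hw.
  + by rewrite op_compZr !htmapZ op_compZr hu.
- by rewrite !(op_comp0l, htmap0).
- by rewrite op_compDl !htmapD op_compDl hu hw.
- by rewrite op_compZl !htmapZ op_compZl hu.
Qed.

Definition hom_tensor : operad_hom (op_tensor P Q) (op_tensor P' Q') :=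
  @OperadHom K (op_tensor P Q) (op_tensor P' Q')
    (fun n i => @htmap n i : {linear _ -> _}) htmap_unit htmap_act htmap_comp.
End HomTensor.

Definition hom_idfun (K : fieldType) (P : operad K) : operad_hom P P :=
  @OperadHom K P P (fun n i => idfun) erefl (fun _ _ _ _ => erefl)
    (fun _ _ _ _ _ _ _ _ _ _ _ => erefl).

Definition hom_compose (K : fieldType) (P Q R : operad K)
  (f : operad_hom Q R) (g : operad_hom P Q) : operad_hom P R.
Proof.
refine (@OperadHom K P R (fun n i => f n i \o g n i) _ _ _).
- abstract by rewrite /= !hom_unit.
- abstract by move=> n i s p; rewrite /= !hom_act.
- abstract by move=> n m r i j l er el a p q; rewrite /= !hom_comp.
Defined.

(** * The associator as a morphism of operads *)

Section Associator.
Variables (K : fieldType) (A B C : int -> lmodType K).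

Lemma tassoc_linear l : linear (@tassoc K A B C l).
Proof. exact: tlift_linear. Qed.
Lemma tassoc_pure l m h i j x (e : l = m + h) (e' : m = i + j)
    (f : l = i + x) (f' : x = j + h) (a : A i) (b : B j) (c : C h) :
  tassoc (tpure e (tpure e' a b) c) = tpure f a (tpure f' b c).
Proof.
subst x; rewrite /tassoc tlift_pure /= tlift_pure /=.
by rewrite (eq_irrelevance (tassoc_deg e e') f).
Qed.

Lemma gtens3_ind l (Pr : gtens (gtens A B) C l -> Prop) :
  (forall (m h i j : int) (e : l = m + h) (e' : m = i + j) a b c,
    Pr (tpure e (tpure e' a b) c)) ->
  Pr 0 -> (forall u v, Pr u -> Pr v -> Pr (u + v)) ->
  (forall c u, Pr u -> Pr (c *: u)) -> forall u, Pr u.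
Proof.
move=> Pp P0 PD PZ; elim/gtens_ind => // m h e u c.
elim/gtens_ind: u => [i j e' a b||u v|k u].
- exact: Pp.
- by rewrite tpure0l.
- by rewrite tpureDl; apply: PD.
- by rewrite tpure_Zl; apply: PZ.
Qed.
End Associator.

Section HomAssociator.
Variables (K : fieldType) (P Q R : operad K).
Local Notation T := (op_tensor (op_tensor P Q) R).
Local Notation T' := (op_tensor P (op_tensor Q R)).

Definition assoc_fun n i : T n i -> T' n i := @tassoc K (P n) (Q n) (R n) i.
Lemma assoc_linear n i : linear (@assoc_fun n i).
Proof. exact: tassoc_linear. Qed.

Lemma assoc0 n i : @assoc_fun n i 0 = 0.
Proof. exact: lin_0 (@assoc_linear n i). Qed.
Lemma assocD n i u v : @assoc_fun n i (u + v) = assoc_fun u + assoc_fun v.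
Proof. exact: lin_D (@assoc_linear n i) u v. Qed.
Lemma assocZ n i c u : @assoc_fun n i (c *: u) = c *: assoc_fun u.
Proof. exact: lin_Z (@assoc_linear n i) c u. Qed.
HB.instance Definition _ n i := GRing.isLinear.Build K (T n i)
  (T' n i) *:%R (@assoc_fun n i) (@assoc_linear n i).

Lemma assoc_unit : assoc_fun (op_unit T) = op_unit T'.
Proof. exact: tassoc_pure. Qed.

Lemma assoc_act n i (s : 'S_n) (u : T n i) :
  assoc_fun (op_act s u) = op_act s (assoc_fun u).
Proof.
elim/gtens3_ind: u => [m h i1 i2 e e' p q w||u v hu hv|c u hu].
- have f : i = i1 + (i2 + h) by rewrite e e' addrA.
  rewrite op_tensor_act (op_tensor_act s e') /assoc_fun.
  by rewrite !(tassoc_pure _ _ f erefl) op_tensor_act (op_tensor_act s erefl).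
- by rewrite op_act0 assoc0 op_act0.
- by rewrite op_actD !assocD op_actD hu hv.
- by rewrite op_actZ !assocZ op_actZ hu.
Qed.

Lemma assoc_comp n m r (i j l : int) (er : r.+1 = (n + m)%N) (el : l = i + j)
    (a : 'I_n) (u : T n i) (v : T m j) :
  assoc_fun (op_comp er el a u v) = op_comp er el a (assoc_fun u) (assoc_fun v).
Proof.
elim/gtens3_ind: u => [i12 i3 i1 i2 ei ei' p1 p2 p3||u w hu hw|c u hu].
- elim/gtens3_ind: v => [j12 j3 j1 j2 ej ej' q1 q2 q3||u w hu hw|c u hu].
  + have e12 : i12 + j12 = (i1 + j1) + (i2 + j2) by rewrite ei' ej' addrACA.
    have e : l = (i12 + j12) + (i3 + j3) by rewrite el ei ej addrACA.
    have f23 : i2 + i3 + (j2 + j3) = (i2 + j2) + (i3 + j3) by rewrite addrACA.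
    have f : l = (i1 + j1) + (i2 + i3 + (j2 + j3)).
      by rewrite e e12 f23; apply: esym (addrA _ _ _).
    have fi : i = i1 + (i2 + i3) by rewrite ei ei' addrA.
    have fj : j = j1 + (j2 + j3) by rewrite ej ej' addrA.
    rewrite (op_tensor_comp _ _ _ _ _ _ _ _ _ e erefl erefl) assocZ.
    rewrite (op_tensor_comp _ _ _ ei' _ _ ej' _ _ e12 erefl erefl).
    rewrite tpure_Zl assocZ /assoc_fun (tassoc_pure _ _ f f23).
    rewrite (tassoc_pure _ _ fi erefl) (tassoc_pure _ _ fj erefl).
    rewrite (op_tensor_comp _ _ _ _ _ _ _ _ _ f erefl erefl).
    rewrite (op_tensor_comp _ _ _ erefl _ _ erefl _ _ f23 erefl erefl).
    rewrite tpure_Zr !scalerA -!expfzDr ?oppr_eq0 ?oner_eq0 //.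
    (* Either bracketing gives the Koszul exponent [i2 * j1 + i3 * j1 + i3 * j2], one product for
       each pair of factors that cross. *)
    by congr (_ ^ _ *: _); rewrite ej'; ring.
  + by rewrite !(op_comp0r, assoc0).
  + by rewrite op_compDr !assocD op_compDr hu hw.
  + by rewrite op_compZr !assocZ op_compZr hu.
- by rewrite !(op_comp0l, assoc0).
- by rewrite op_compDl !assocD op_compDl hu hw.
- by rewrite op_compZl !assocZ op_compZl hu.
Qed.

Definition hom_assoc : operad_hom T T' :=
  @OperadHom K T T' (fun n i => @assoc_fun n i : {linear _ -> _})
    assoc_unit assoc_act assoc_comp.
End HomAssociator.

Lemma hom_op_prod (K : fieldType) (P Q : operad K) (f : operad_hom P Q) mu m :
  f m.+1 0 (op_prod mu m) = op_prod (f 2%N 0 mu) m.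
Proof. by elim: m => [|m IH] /=; rewrite ?hom_unit // hom_comp IH. Qed.

(** All Koszul signs are trivial in degree 0. Hence a morphism sending [mu] to mu (x) mu sends mu^{o
    k} to its own tensor square. *)
Lemma op_prod_tensor (K : fieldType) (P Q : operad K) mu mu' m
    (e : 0 = 0 + 0 :> int) :
  op_prod (tpure e mu mu' : op_tensor P Q 2%N 0) m =
  tpure e (op_prod mu m) (op_prod mu' m).
Proof.
elim: m => [|m IH] /=; first by congr tpure; apply: eq_irrelevance.
have e0 := esym (addr0 (0 : int)).
rewrite IH; apply: etrans (op_tensor_comp _ _ _ _ _ _ _ _ _ e e0 e0) _.
rewrite mul0r expr0z scale1r.
by congr tpure; congr op_comp; apply: eq_irrelevance.
Qed.

(** * Morphisms out of [Pois]: comparison on generators and coassociativity *)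

Section PoisHom.
Variables (K : fieldType) (k : nat) (d : int).
Local Notation P := (Pois K k d).

(** Every element is the class of a formal expression in the generators, and a morphism respects
    each constructor of expressions. *)
Lemma pois_hom_ext (Q : operad K) (f g : operad_hom P Q) :
  f _ _ (pois_mu K k d) = g _ _ (pois_mu K k d) ->
  f _ _ (pois_nu K k d) = g _ _ (pois_nu K k d) ->
  forall n i (x : P n i), f n i x = g n i x.
Proof.
move=> hmu hnu n i u; have [x ->] := pois_pi_surj u.
elim: x => {n i u} //.
- by rewrite -[pois_pi _]/(op_unit P) !hom_unit.
- by move=> n i; rewrite -[pois_pi _]/(0 : P n i) !linear0.
- move=> n i x hx y hy; have -> : pois_pi (Eadd x y) = pois_pi x + pois_pi y.
    exact: jpi_add.
  transitivity (f n i (pois_pi x) + f n i (pois_pi y)); first exact: linearD.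
  by rewrite hx hy; apply/esym; apply: linearD.
- move=> n i c x hx; have -> : pois_pi (Escale c x) = c *: pois_pi x.
    exact: jpi_scale.
  transitivity (c *: f n i (pois_pi x)); first exact: linearZ.
  by rewrite hx; apply/esym; apply: linearZ.
- move=> n i s x hx.
  have -> : pois_pi (Eact s x) = op_act s (pois_pi x : P n i).
    by apply: pois_ext => M; rewrite pois_lift_act !pois_lift_pi.
  by rewrite !hom_act hx.
- move=> n m r i j l er el a x hx y hy.
  have -> : pois_pi (Ecomp er el a x y) =
      op_comp er el a (pois_pi x : P n i) (pois_pi y).
    by apply: pois_ext => M; rewrite pois_lift_comp !pois_lift_pi.
  by rewrite !hom_comp hx hy.
Qed.

Lemma extends_coassociative (D : operad_hom P (op_tensor P P)) :
  extends_generators D -> coassociative D.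
Proof.
case=> Dmu Dnu n i x.
have DM : D k.+1 0 (op_prod (pois_mu K k d) k) =
    tpure (esym (addr0 0)) (op_prod (pois_mu K k d) k) (op_prod (pois_mu K k d) k).
  by rewrite hom_op_prod Dmu op_prod_tensor.
pose f := hom_compose (hom_assoc P P P)
  (hom_compose (hom_tensor D (hom_idfun P)) D).
pose g := hom_compose (hom_tensor (hom_idfun P) D) D.
have fg : forall n i x, f n i x = g n i x; last exact: fg.
have z0 : 0 = 0 + 0 :> int by rewrite addr0.
have e0 := add0r (nu_deg k d); have e1 := addr0 (nu_deg k d).
apply: pois_hom_ext; rewrite /f /g /= ?Dmu ?Dnu ?linearD /= !htmap_pure /= ?Dmu ?Dnu.
  by rewrite /assoc_fun (tassoc_pure _ _ z0 z0) (eq_irrelevance (esym (addr0 0)) z0).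
(* With M = mu^{o k}, both sides at [nu] become M (x) M (x) nu + M (x) nu (x) M + nu (x) M (x) M;
   what remains is to rebracket and identify the proofs of degree equations. *)
rewrite !DM !(tpureDl, tpureDr) linearD /= /assoc_fun.
rewrite (tassoc_pure _ _ (esym e0) (esym e0)).
rewrite (tassoc_pure _ _ (esym e0) (esym e1)).
rewrite (tassoc_pure _ _ (esym e1) z0).
rewrite addrA (eq_irrelevance (esym e0) (esym (add0r _))).
rewrite (eq_irrelevance (esym e1) (esym (addr0 _))).
by rewrite (eq_irrelevance z0 (esym (addr0 0))).
Qed.
End PoisHom.

(** * Permutations of the inputs of a composite *)

(** A permutation preserving the fibres of [f] is a product of transpositions inside fibres:
    [s * tperm x (s x)] fixes [x] and every fixed point of [s], so the support shrinks. Different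
    choices of [f] give the full symmetric group, the Young subgroup, or the permutations of a
    single block. *)
Lemma perm_ind_tperm (T : finType) (C : eqType) (f : T -> C)
    (Pr : {perm T} -> Prop) :
  Pr 1%g ->
  (forall (s : {perm T}) x y, f x = f y -> Pr s -> Pr (s * tperm x y)%g) ->
  forall s : {perm T}, (forall x, f (s x) = f x) -> Pr s.
Proof.
move=> P1 PM s; move: {2}_.+1 (ltnSn #|[set x | s x != x]|) => n.
elim: n s => // n IH s; rewrite ltnS => hn fs.
have [/forallP s1|] := boolP [forall x, s x == x].
  by rewrite (_ : s = 1%g) //; apply/permP => x; rewrite perm1 (eqP (s1 x)).
rewrite negb_forall => /existsP[x sx].
have fx : f x = f (s x) by rewrite fs.
rewrite -[s]mulg1 -(tperm2 x (s x)) mulgA; apply: PM fx _; apply: IH; last first.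
  by move=> y; rewrite permM -[RHS]fs; case: tpermP => [->|->|].
apply: leq_trans hn; apply/proper_card/properP; split.
  apply/subsetP=> y; rewrite !inE permM; apply: contraNN => /eqP sy.
  case: tpermP; rewrite ?sy // => e; first by rewrite -e sy e eqxx in sx.
  by rewrite -(inj_eq (@perm_inj _ s)) -e sy.
by exists x; rewrite !inE // permM tpermR negbK.
Qed.

(** Reversing the inputs exchanges first and last slots. It carries the Leibniz identity from one
    end of [nu] to the other, and the two cross terms of the Jacobi identity into each other. *)
Definition rev_perm n : 'S_n := perm (@rev_ord_inj n).

Lemma rev_permE n (i : 'I_n) : rev_perm n i = (n - i.+1)%N :> nat.
Proof. by rewrite permE. Qed.

Lemma rev_perm2 n : (rev_perm n * rev_perm n = 1)%g.
Proof. by apply/permP => i; rewrite permM !permE rev_ordK. Qed.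

Lemma odd_rev_permS n : rev_perm n.+1 = odd n (+) rev_perm n :> bool.
Proof.
suff -> : rev_perm n.+1 = lift_perm ord0 ord_max (rev_perm n).
  by rewrite odd_lift_perm.
apply/permP => i; have [j ->|->] := unliftP ord0 i; apply/val_inj; last first.
  by rewrite lift_perm_id /= rev_permE subSS subn0.
rewrite lift_perm_lift /= !rev_permE /= /bump /=.
by have := ltn_ord j; rewrite /= => lj; case: leqP; lia.
Qed.

(** The reversal of 2k + 1 points has k(2k + 1) inversions, a number of the parity of k. *)
Lemma odd_rev_perm k : rev_perm (k + k).+1 = odd k :> bool.
Proof.
elim: k => [|k IH].
  by rewrite odd_rev_permS (_ : rev_perm 0 = 1%g) ?odd_perm1 //; apply/permP => -[].
by rewrite addSn addnS odd_rev_permS odd_rev_permS IH /= addnn odd_double.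
Qed.

(** * Slots of a partial composite and the block permutations acting on them *)

Lemma outer_slot_lt n m r (a j : 'I_n) :
  r.+1 = (n + m)%N -> j != a -> (outer_slot a m j < r)%N.
Proof.
rewrite -(inj_eq val_inj) /outer_slot /=.
by have := ltn_ord j; have := ltn_ord a; case: ifP; lia.
Qed.

Lemma inner_slot_lt n m r (a : 'I_n) (j : 'I_m) :
  r.+1 = (n + m)%N -> (a + j < r)%N.
Proof. by have := ltn_ord j; have := ltn_ord a; lia. Qed.

Lemma outer_slot_inj n m (a j j' : 'I_n) : j != a -> j' != a ->
  outer_slot a m j = outer_slot a m j' -> j = j'.
Proof.
rewrite -!(inj_eq val_inj) /outer_slot /= => ja ja' h; apply/val_inj => /=.
by move: h; do 2![case: ifP]; lia.
Qed.

Lemma outer_neq_inner n m (a j : 'I_n) (i : 'I_m) : j != a ->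
  outer_slot a m j <> (a + i)%N.
Proof.
rewrite -(inj_eq val_inj) /outer_slot /=; have := ltn_ord i; case: ifP; lia.
Qed.

Lemma slotP n m r (a : 'I_n) (u : 'I_r) : r.+1 = (n + m)%N ->
  (exists2 j : 'I_n, j != a & u = outer_slot a m j :> nat) \/
  (exists j : 'I_m, u = (a + j)%N :> nat).
Proof.
move=> er; have := ltn_ord u; have := ltn_ord a => la lu.
have [ua|au] := ltnP u a.
  have un : (u < n)%N by lia.
  left; exists (Ordinal un); first by rewrite -(inj_eq val_inj) /=; lia.
  by rewrite /outer_slot /= ua.
have [uam|amu] := ltnP u (a + m)%N.
  have um : (u - a < m)%N by lia.
  by right; exists (Ordinal um); rewrite /= subnKC.
have un : (u.+1 - m < n)%N by lia.
left; exists (Ordinal un); first by rewrite -(inj_eq val_inj) /=; lia.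
by rewrite /outer_slot /=; case: ifP; lia.
Qed.

(** The two clauses of [block_perm] prescribe values on the outer and on the inner slots, which by
    [slotP] cover the composite and are disjoint. Injectivity holds because the images are again
    outer and inner slots, relative to [s a]. *)
Lemma block_perm_exists n m r (a : 'I_n) (s : 'S_n) (t : 'S_m) :
  r.+1 = (n + m)%N -> exists rho : 'S_r, block_perm a s t rho.
Proof.
move=> er.
have [u|f fP] := @fin_all_exists 'I_r (fun=> 'I_r) (fun u v =>
  (forall j : 'I_n, j != a -> u = outer_slot a m j :> nat ->
     v = outer_slot (s a) m (s j) :> nat) /\
  (forall j : 'I_m, u = (a + j)%N :> nat -> v = (s a + t j)%N :> nat)).
  have [[j ja uj]|[j uj]] := slotP a u er.
    have sja : s j != s a by rewrite (inj_eq perm_inj).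
    exists (Ordinal (outer_slot_lt er sja)); split=> [j' ja' /=|j'].
      by rewrite uj => /(outer_slot_inj ja ja') <-.
    by rewrite uj => /(outer_neq_inner ja).
  exists (Ordinal (inner_slot_lt (s a) (t j) er)); split=> [j' ja' |j' /=].
    by rewrite uj => /esym/(outer_neq_inner ja').
  by rewrite uj => /addnI/val_inj <-.
have finj : injective f.
  move=> u u' /(congr1 val) /=; have [f1 f2] := fP u; have [f1' f2'] := fP u'.
  have [[j ja uj]|[j uj]] := slotP a u er.
    have sja : s j != s a by rewrite (inj_eq perm_inj).
    rewrite (f1 _ ja uj); have [[j' ja' uj']|[j' uj']] := slotP a u' er.
      have sja' : s j' != s a by rewrite (inj_eq perm_inj).
      rewrite (f1' _ ja' uj') => /(outer_slot_inj sja sja')/perm_inj jj'.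
      by apply/val_inj; rewrite /= uj uj' jj'.
    by rewrite (f2' _ uj') => /(outer_neq_inner sja).
  rewrite (f2 _ uj); have [[j' ja' uj']|[j' uj']] := slotP a u' er.
    have sja' : s j' != s a by rewrite (inj_eq perm_inj).
    by rewrite (f1' _ ja' uj') => /esym/(outer_neq_inner sja').
  rewrite (f2' _ uj') => /addnI/val_inj/perm_inj jj'.
  by apply/val_inj; rewrite /= uj uj' jj'.
exists (perm finj); split=> [j u ja uj|j u uj]; rewrite permE.
  by have [f1 _] := fP u; apply: f1.
by have [_ f2] := fP u; apply: f2.
Qed.

Lemma block_perm_rev n m r (a : 'I_n) : r.+1 = (n + m)%N ->
  block_perm a (rev_perm n) (rev_perm m) (rev_perm r).
Proof.
move=> er; split=> [j u|j u uj]; rewrite !rev_permE.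
  rewrite -(inj_eq val_inj) /outer_slot /=.
  have := ltn_ord j; have := ltn_ord a; have := ltn_ord u.
  by case: ifP; case: ifP; lia.
by have := ltn_ord j; have := ltn_ord a; lia.
Qed.

Lemma block_perm_inner n m r (a : 'I_n) (x y : 'I_m) (x' y' : 'I_r) :
  x' = (a + x)%N :> nat -> y' = (a + y)%N :> nat ->
  block_perm a 1 (tperm x y) (tperm x' y').
Proof.
move=> ex ey; split=> [j u ja|j u]; rewrite !perm1 => uj; last first.
  case: (tpermP x y j) => [jx|jy|jx jy].
  - by rewrite (_ : u = x') ?tpermL //; apply/val_inj; rewrite /= uj jx.
  - by rewrite (_ : u = y') ?tpermR //; apply/val_inj; rewrite /= uj jy.
  rewrite tpermD ?uj //; apply/eqP => /(congr1 val) /=; rewrite uj.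
    by rewrite ex => /addnI/val_inj/esym.
  by rewrite ey => /addnI/val_inj/esym.
rewrite tpermD ?uj //; apply/eqP => /(congr1 val) /=; rewrite uj.
  by rewrite ex => /esym/(outer_neq_inner ja).
by rewrite ey => /esym/(outer_neq_inner ja).
Qed.

Lemma block_perm_outer n m r (a x y : 'I_n) (x' y' : 'I_r) :
  x != a -> y != a ->
  x' = outer_slot a m x :> nat -> y' = outer_slot a m y :> nat ->
  block_perm a (tperm x y) (1 : 'S_m) (tperm x' y').
Proof.
move=> xa ya ex ey; split=> [j u ja|j u] uj; rewrite (tpermD xa ya) ?perm1.
  case: (tpermP x y j) => [jx|jy|jx jy].
  - by rewrite (_ : u = x') ?tpermL //; apply/val_inj; rewrite /= uj jx.
  - by rewrite (_ : u = y') ?tpermR //; apply/val_inj; rewrite /= uj jy.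
  rewrite tpermD ?uj //; apply/eqP => /(congr1 val) /=; rewrite uj.
    by rewrite ex => /(outer_slot_inj xa ja)/esym.
  by rewrite ey => /(outer_slot_inj ya ja)/esym.
rewrite tpermD ?uj //; apply/eqP => /(congr1 val) /=; rewrite uj.
  by rewrite ex => /(outer_neq_inner xa).
by rewrite ey => /(outer_neq_inner ya).
Qed.

(** * Iterated products and the Leibniz rule *)

Lemma op_comp_irr (K : fieldType) (P : operad K) n m r (i j l : int)
    (er er' : r.+1 = (n + m)%N) (el el' : l = i + j) (a : 'I_n)
    (p : P n i) (q : P m j) : op_comp er el a p q = op_comp er' el' a p q.
Proof. by rewrite (eq_irrelevance er er') (eq_irrelevance el el'). Qed.

Section CommutativeProducts.
Variables (K : fieldType) (P : operad K) (mu : P 2%N 0).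
Hypothesis mu_sym : forall s : 'S_2, op_act s mu = mu.
Hypothesis mu_assoc :
  op_comp (erefl : 4%N = (2 + 2)%N) (esym (addr0 0)) ord0 mu mu =
  op_comp (erefl : 4%N = (2 + 2)%N) (esym (addr0 0)) ord_max mu mu.

(** [op_prod] grafts into the first slot of [mu]; associativity allows the last slot as well. *)
Lemma op_prod_mu m (er : m.+3 = (2 + m.+1)%N) (el : 0 = 0 + 0 :> int) :
  op_comp er el ord_max mu (op_prod mu m) = op_prod mu m.+1.
Proof.
elim: m er el => [|m IH] er el; first by rewrite /= !op_comp_unitr.
have f : 0 = 0 + 0 :> int := esym (addr0 0).
(* The middle input of a threefold product: the first input of the inner [mu] in x(yz), the last one
   in (xy)z. *)
pose c1 := Ordinal (isT : 1 < 3)%N.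
apply: etrans (esym (op_comp_seq (erefl : 4 = 2 + 2)%N (esym (addr0 0))
  (erefl : m.+4 = 3 + m.+1)%N f _ _ _ _ (c := c1) _ _ _ _)) _ => //.
rewrite -mu_assoc.
apply: etrans (op_comp_seq _ _ _ _ (erefl : m.+3 = 2 + m.+1)%N f
  (erefl : m.+4 = 2 + m.+2)%N f (b := ord_max) _ _ _ _) _ => //.
by rewrite IH; apply: op_comp_irr.
Qed.

Lemma op_prod_comp0 n m r (er : r.+2 = (n.+1 + m.+1)%N) (el : 0 = 0 + 0 :> int) :
  op_comp er el ord0 (op_prod mu n) (op_prod mu m) = op_prod mu r.
Proof.
have f : 0 = 0 + 0 :> int := esym (addr0 0).
elim: n r er el => [|n IH] r er el.
  have e : r = m by lia.
  by subst r; apply: op_comp_unitl.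
case: r er => [|r] er; first lia.
have e : r.+2 = (n.+1 + m.+1)%N by lia.
apply: etrans (op_comp_seq _ _ _ _ e f
  (erefl : r.+3 = 2 + r.+1)%N f (b := ord0) _ _ _ _) _ => //.
by rewrite IH; apply: op_comp_irr.
Qed.

(** Transpositions suffice. From three inputs on, grafting into the first slot of [mu] handles those
    missing the last input ([tl]), and grafting into the last slot those missing the first input
    ([tr]), both by induction. Only the exchange of the two extreme inputs is left. *)
Lemma op_prod_sym m (s : 'S_m.+1) : op_act s (op_prod mu m) = op_prod mu m.
Proof.
elim: m s => [|[_ s|m IH s]].
- move=> s; rewrite (_ : s = 1%g) ?op_act1 //.
  by apply/permP => i; rewrite !ord1.
- by rewrite (_ : op_prod mu 1 = mu) //; apply: op_comp_unitr.
have tl (x y : 'I_m.+3) : (x < m.+2)%N -> (y < m.+2)%N ->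
    op_act (tperm x y) (op_prod mu m.+2) = op_prod mu m.+2.
  move=> lx ly; have := @op_comp_equiv _ P _ _ _ _ _ _
    (erefl : m.+4 = (2 + m.+2)%N) (esym (addr0 0)) ord0 _ _ _
    mu (op_prod mu m.+1)
    (block_perm_inner (a := ord0) (x := Ordinal lx) (y := Ordinal ly)
      (x' := x) (y' := y) erefl erefl).
  by rewrite perm1 op_act1 IH => <-.
have tr (x y : 'I_m.+3) : (0 < x)%N -> (0 < y)%N ->
    op_act (tperm x y) (op_prod mu m.+2) = op_prod mu m.+2.
  move=> x0 y0; have lx : (x.-1 < m.+2)%N by have := ltn_ord x; lia.
  have ly : (y.-1 < m.+2)%N by have := ltn_ord y; lia.
  have ex : x = (@ord_max 1 + Ordinal lx)%N :> nat by rewrite /= add1n prednK.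
  have ey : y = (@ord_max 1 + Ordinal ly)%N :> nat by rewrite /= add1n prednK.
  have := @op_comp_equiv _ P _ _ _ _ _ _
    (erefl : m.+4 = (2 + m.+2)%N) (esym (addr0 0)) ord_max _ _ _
    mu (op_prod mu m.+1) (block_perm_inner ex ey).
  by rewrite perm1 op_act1 IH op_prod_mu => <-.
have tlast : op_act (tperm ord0 ord_max) (op_prod mu m.+2) = op_prod mu m.+2.
  pose o1 : 'I_m.+3 := lift ord0 ord0.
  (* The exchange of the extremes is conjugated into a transposition avoiding input 0, by one
     avoiding the last input. *)
  rewrite (_ : tperm ord0 ord_max = tperm o1 ord_max ^ tperm ord0 o1)%g.
    by rewrite conjgE tpermV -!op_actM tl // tr // tl.
  by rewrite tpermJ tpermR tpermD //; apply/eqP.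
apply: (perm_ind_tperm (f := fun=> tt)
  (Pr := fun s => op_act s (op_prod mu m.+2) = op_prod mu m.+2))
  => [|{}s x y _ hs|//].
  exact: op_act1.
rewrite -op_actM hs.
have [x0|x0] := posnP x; last first.
  have [y0|y0] := posnP y; last exact: tr.
  rewrite tpermC; have [xm|xm] := ltnP x m.+2; first by apply: tl; rewrite ?y0.
  have -> : y = ord0 by apply/val_inj.
  have -> : x = ord_max by apply/val_inj; have := ltn_ord x; rewrite /=; lia.
  exact: tlast.
have [ym|ym] := ltnP y m.+2; first by apply: tl; rewrite ?x0.
have -> : x = ord0 by apply/val_inj.
have -> : y = ord_max by apply/val_inj; have := ltn_ord y; rewrite /=; lia.
exact: tlast.
Qed.

Lemma op_prod_comp n m r (er : r.+2 = (n.+1 + m.+1)%N) (el : 0 = 0 + 0 :> int)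
    (a : 'I_n.+1) :
  op_comp er el a (op_prod mu n) (op_prod mu m) = op_prod mu r.
Proof.
(* By symmetry of the outer product, slot [a] may be traded for slot 0. *)
have [rho hrho] := block_perm_exists ord0 (tperm ord0 a) (1%g : 'S_m.+1) er.
have := op_comp_equiv er el (op_prod mu n) (op_prod mu m) hrho.
by rewrite tpermL !op_prod_sym op_prod_comp0 op_prod_sym.
Qed.
End CommutativeProducts.

Section PoissonComposites.
Variables (K : fieldType) (k : nat) (d : int) (P : operad K).
Variables (mu : P 2%N 0) (nu : P k.+1 (nu_deg k d)).
Hypothesis rel : pois_relations mu nu.
Local Notation M := (op_prod mu).
Local Notation dnu := (nu_deg k d).

Let mu_sym := pois_mu_sym rel.
Let mu_assoc := pois_mu_assoc rel.

(** The character by which the symmetric group acts on [nu]; its values are their own inverses. *)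
Definition sign_char n (s : 'S_n) : K := ((-1) ^+ s) ^ d.
Local Notation chi := sign_char.

Lemma chi1 n : chi (1 : 'S_n) = 1.
Proof. by rewrite /sign_char odd_perm1 expr0 exp1rz. Qed.

Lemma chiM n (s t : 'S_n) : chi (s * t) = chi s * chi t.
Proof. by rewrite /sign_char odd_permM signr_addb expfzMl. Qed.

Lemma chi_sqr n (s : 'S_n) : chi s * chi s = 1.
Proof. by rewrite -expfzMl -signr_addb addbb exp1rz. Qed.

(** Reversing all inputs carries the defining Leibniz identity, at the last slot of [nu], to slot 0.
    Each term acquires the same sign [c] from [nu], and none from [mu], so the sign cancels. *)
Lemma leibniz0 (er : k.+3 = (k.+1 + 2)%N) (er' : k.+3 = (2 + k.+1)%N)
    (el : dnu = dnu + 0) (el' : dnu = 0 + dnu) :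
  op_comp er el ord0 nu mu =
  op_act (tperm ord0 (lift ord0 ord0)) (op_comp er' el' ord_max mu nu)
  + op_comp er' el' ord_max mu nu.
Proof.
set X := op_comp er' _ _ _ _; pose c := chi (rev_perm k.+1).
have cN0 : c != 0.
  apply/eqP => c0; have := chi_sqr (rev_perm k.+1).
  by rewrite -/c c0 mul0r => /esym/eqP; rewrite oner_eq0.
apply/(scalerI cN0).
have hl : op_act (rev_perm k.+2) (op_comp er el ord_max nu mu) =
    c *: op_comp er el ord0 nu mu.
  rewrite -(op_comp_equiv er el _ _ (block_perm_rev ord_max er)).
  rewrite (pois_nu_sym rel) mu_sym op_compZl.
  rewrite (_ : rev_perm k.+1 ord_max = ord0) //.
  by apply/val_inj; rewrite /= rev_permE subnn.
have hr : op_act (rev_perm k.+2) (op_comp er' el' ord0 mu nu) = c *: X.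
  rewrite -(op_comp_equiv er' el' _ _ (block_perm_rev ord0 er')).
  rewrite (pois_nu_sym rel) mu_sym op_compZr.
  rewrite (_ : rev_perm 2 ord0 = ord_max) //.
  by apply/val_inj; rewrite /= rev_permE.
rewrite -hl (op_comp_irr er (leibniz_arity k) el (esym (addr0 _))).
rewrite (pois_leibniz rel).
rewrite (op_comp_irr _ er' _ el') op_actD hr scalerDr; congr (_ + _).
rewrite -op_actZ -hr !op_actM; congr op_act.
(* The reversal conjugates the exchange of the last two inputs into that of the first two. *)
rewrite conjgC tpermJ tpermC; congr (_ * tperm _ _)%g; apply/val_inj.
  by rewrite /= rev_permE subnn.
by rewrite /= rev_permE inordK // subSS subSn // subnn.
Qed.

(* M_m o_m nu is x_0 ... x_(m-1) nu(x_m, ..., x_(m+k)); the permutations [cs]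
   choose which of the slots 0, ..., m enters nu. *)
Lemma leibniz_prod m r (er : r.+1 = (k.+1 + m.+1)%N)
    (er' : r.+1 = (m.+1 + k.+1)%N) (el : dnu = dnu + 0) (el' : dnu = 0 + dnu) :
  exists cs : seq 'S_r,
    (forall c, c \in cs -> forall u : 'I_r, (m < u)%N -> c u = u) /\
    op_comp er el ord0 nu (M m) =
    \sum_(c <- cs) op_act c (op_comp er' el' ord_max (M m) nu).
Proof.
elim: m r er er' => [|m IH] r er er'.
  have e : r = k.+1 by lia.
  subst r; exists [:: 1%g]; split=> [c|].
    by rewrite inE => /eqP-> u; rewrite perm1.
  by rewrite big_seq1 op_act1 /= op_comp_unitl op_comp_unitr.
case: r er er' => [|r] er er'; first lia.
have e : r.+1 = (k.+1 + m.+1)%N by lia.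
have e' : r.+1 = (m.+1 + k.+1)%N by lia.
have e2 : r.+2 = (k.+2 + m.+1)%N by lia.
have e1 : k.+3 = (k.+1 + 2)%N by lia.
have [cs [hcs hM]] := IH r e e'.
pose o1 : 'I_k.+2 := lift ord0 ord0.
pose X := op_comp (erefl : k.+3 = (2 + k.+1)%N) el' ord_max mu nu.
pose Y := op_comp er' el' ord_max (M m.+1) nu.
(* As [M m.+1] is [mu] with [M m] in slot 0, one Leibniz step leaves two terms. If [M m] lands
   outside [nu], the term is already [Y] ([h0]); if it lands inside, the term is [mu] composed with
   the previous case, up to the permutation [rho] ([h1], [h2]). *)
have lhs : op_comp er el ord0 nu (M m.+1) =
    op_comp e2 el ord0 (op_act (tperm ord0 o1) X) (M m) +
    op_comp e2 el ord0 X (M m).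
  rewrite -op_compDl -(leibniz0 e1 _ el); apply: esym.
  by apply: (@op_comp_seq _ P _ _ _ _ _ _ _ _ _ _ _ _ e1 el e2 el
    (erefl : m.+3 = 2 + m.+1)%N (esym (addr0 0)) er el ord0 ord0 ord0).
have h0 : op_comp e2 el ord0 X (M m) = Y.
  apply: etrans (@op_comp_par _ P _ _ _ _ _ _ _ _ _ _ _ _
    (erefl : k.+3 = 2 + k.+1)%N el' e2 el (erefl : m.+3 = 2 + m.+1)%N
    (esym (addr0 0)) er' el' ord0 ord_max ord0 ord_max mu nu (M m) _ _ _) _ => //.
  by rewrite mulr0 expr0z scale1r.
have [rho hrho] := block_perm_exists o1 (tperm ord0 o1) (1%g : 'S_m.+1) e2.
have h1 : op_comp e2 el ord0 (op_act (tperm ord0 o1) X) (M m) =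
    op_act rho (op_comp e2 el o1 X (M m)).
  by rewrite -(op_comp_equiv _ _ _ _ hrho) tpermR op_act1.
have h2 : op_comp e2 el o1 X (M m) =
    op_comp (erefl : r.+2 = 2 + r)%N el' ord_max mu (op_comp e el ord0 nu (M m)).
  by apply: (@op_comp_seq _ P _ _ _ _ _ _ _ _ _ _ _ _
    (erefl : k.+3 = 2 + k.+1)%N el' e2 el e el (erefl : r.+2 = 2 + r)%N el').
have [lft hlft] := @fin_all_exists 'S_r (fun=> 'S_r.+1)
  (fun c => block_perm (@ord_max 1) 1 c)
  (fun c => block_perm_exists _ _ _ (erefl : r.+2 = 2 + r)%N).
have h3 c : op_comp (erefl : r.+2 = 2 + r)%N el' ord_max mu
      (op_act c (op_comp e' el' ord_max (M m) nu)) = op_act (lft c) Y.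
  have := op_comp_equiv (erefl : r.+2 = 2 + r)%N el' mu
    (op_comp e' el' ord_max (M m) nu) (hlft c).
  rewrite perm1 op_act1 => ->; congr op_act.
  rewrite /Y -(op_prod_mu mu_assoc (erefl : m.+3 = 2 + m.+1)%N (esym (addr0 0))).
  apply: esym; exact: (@op_comp_seq _ P _ _ _ _ _ _ _ _ _ _ _ _
    (erefl : m.+3 = 2 + m.+1)%N (esym (addr0 0)) er' el' e' el'
    (erefl : r.+2 = 2 + r)%N el' ord_max ord_max ord_max).
(* The identity accounts for [Y]; the other permutations come from the induction hypothesis, carried
   through the last slot of [mu] and then permuted by [rho]. *)
exists (1%g :: [seq (lft c * rho)%g | c <- cs]); split; last first.
  rewrite lhs h0 h1 h2 hM op_comp_sumr op_act_sum big_cons op_act1 big_map addrC.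
  by congr (_ + _); apply: eq_bigr => c _; rewrite h3 op_actM.
(* For [u] beyond [m.+1], [lft c] acts on [u] as [c] acts on [u.-1], which is beyond [m]; and [rho]
   fixes [u] because the corresponding outer slot is neither 0 nor 1. *)
move=> c; rewrite inE => /predU1P[->|/mapP[{}c hc ->]] u mu_u; rewrite ?perm1 //.
have lu := ltn_ord u; have o1E : o1 = 1%N :> nat by [].
have lc : lft c u = u.
  have lv : (u.-1 < r)%N by lia.
  have uE : u = (@ord_max 1 + Ordinal lv)%N :> nat by rewrite /=; lia.
  apply/val_inj; rewrite /= ((hlft c).2 _ _ uE) perm1 /= (hcs c hc) //=; lia.
have lj : (u - m < k.+2)%N by lia.
have jN : Ordinal lj != o1 by rewrite -(inj_eq val_inj) [val o1]o1E /=; lia.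
have uE : u = outer_slot o1 m.+1 (Ordinal lj) :> nat.
  by rewrite /outer_slot o1E /=; case: ifP; lia.
rewrite permM lc; apply/val_inj; rewrite /= (hrho.1 _ _ jN uE) tpermR tpermD //.
  by rewrite /outer_slot /=; lia.
  by rewrite -(inj_eq val_inj) /=; lia.
by rewrite eq_sym.
Qed.
End PoissonComposites.

(** * The Jacobi identity in the tensor square *)

(** Summation coset by coset: [f] is constant on each right coset of [H], which has [#|H|] elements
    and meets [X] once. *)
Lemma sum_transversal (gT : finGroupType) (V : nmodType) (H X : {set gT})
    (f : gT -> V) :
  is_transversal X (rcosets H [set: gT]) [set: gT] ->
  (forall h g, h \in H -> f (h * g)%g = f g) ->
  \sum_g f g = (\sum_(x in X) f x) *+ #|H|.
Proof.
case/and3P=> pX _ /'forall_implyP tX fH.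
rewrite -[LHS](eq_bigl _ _ (fun g => in_setT g)) (set_partition_big _ pX) /=.
have -> : \sum_(x in X) f x =
    \sum_(B in rcosets H [set: gT]) \sum_(x in B | x \in X) f x.
  rewrite -(set_partition_big_cond _ pX) /=.
  by apply: eq_bigl => x; rewrite inE.
rewrite -sumrMnl; apply: eq_bigr => B hB.
have /cards1P[x Bx] := tX _ hB.
have -> : \sum_(y in B | y \in X) f y = f x.
  have <- : \sum_(y in [set x]) f y = f x by rewrite big_set1.
  rewrite -Bx; apply: eq_bigl => y.
  by rewrite !inE andbC.
have xB : x \in B by have := set11 x; rewrite -Bx inE => /andP[].
case/rcosetsP: hB xB => g _ -> /rcosetP[h hH ->]; rewrite fH //.
rewrite -(card_rcoset H g) -sumr_const.
by apply: eq_bigr => y /rcosetP[h' hH' ->]; rewrite fH.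
Qed.

(** * Antisymmetrization twisted by [chi] *)

Section Antisymmetrization.
Variables (K : fieldType) (Q : operad K) (d : int) (n : nat) (i : int).
Local Notation chi := (sign_char K d).

(** Up to the factor n!, the projection onto the [chi]-isotypic part. *)
Definition antisym (v : Q n i) : Q n i := \sum_(s : 'S_n) chi s *: op_act s v.

Lemma antisym_act h v : antisym (op_act h v) = chi h *: antisym v.
Proof.
rewrite /antisym scaler_sumr [RHS](reindex_inj (mulgI h)) /=.
by apply: eq_bigr => s _; rewrite op_actM scalerA chiM mulrA chi_sqr mul1r.
Qed.

Lemma antisym_sum I (r : seq I) (F : I -> Q n i) :
  antisym (\sum_(x <- r) F x) = \sum_(x <- r) antisym (F x).
Proof.
rewrite exchange_big /=; apply: eq_bigr => s _.
by rewrite op_act_sum scaler_sumr.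
Qed.

Lemma antisymD u v : antisym (u + v) = antisym u + antisym v.
Proof.
by rewrite -big_split /=; apply: eq_bigr => s _; rewrite op_actD scalerDr.
Qed.

Lemma antisymZ c v : antisym (c *: v) = c *: antisym v.
Proof.
rewrite scaler_sumr; apply: eq_bigr => s _.
by rewrite op_actZ !scalerA mulrC.
Qed.
End Antisymmetrization.

Section Jacobi.
Variables (K : fieldType) (k : nat) (d : int) (P : operad K).
Variables (mu : P 2%N 0) (nu : P k.+1 (nu_deg k d)).
Hypothesis rel : pois_relations mu nu.
Hypothesis char0 : [pchar K] =i pred0.
Local Notation M := (op_prod mu k).
Local Notation dnu := (nu_deg k d).
Local Notation chi := (sign_char K d).

Let mu_sym := pois_mu_sym rel.
Let mu_assoc := pois_mu_assoc rel.

Local Notation eM := (esym (add0r dnu)).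
Local Notation eN := (esym (addr0 dnu)).
(** In terms of arguments, [A] is nu(x_0, ..., x_k) x_(k+1) ... x_(2k), [B] is x_0 ... x_(k-1)
    nu(x_k, ..., x_(2k)), and [C] is nu(x_0 ... x_k, x_(k+1), ..., x_(2k)). *)
Let A : P (k + k).+1 dnu := op_comp (jacobi_arity k) eM ord0 M nu.
Let B : P (k + k).+1 dnu := op_comp (jacobi_arity k) eM ord_max M nu.
Let C : P (k + k).+1 dnu := op_comp (jacobi_arity k) eN ord0 nu M.

Lemma chi_tperm n m (x y : 'I_n) (x' y' : 'I_m) : (x == y) = (x' == y') ->
  chi (tperm x y) = chi (tperm x' y').
Proof. by rewrite /sign_char !odd_tperm => ->. Qed.

(** Equivariance pushes the transposition into the inner operation. The clause on [x' == y']
    preserves its parity, hence the value of [chi]. *)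
Lemma act_tperm_inner (i j l : int) (el : l = i + j) (p : P k.+1 i)
    (q : P k.+1 j) (x y : 'I_(k + k).+1) : (x <= k)%N -> (y <= k)%N ->
  exists x' y' : 'I_k.+1, (x' == y') = (x == y) /\
  op_act (tperm x y) (op_comp (jacobi_arity k) el ord0 p q) =
  op_comp (jacobi_arity k) el ord0 p (op_act (tperm x' y') q).
Proof.
move=> xk yk; exists (Ordinal (xk : x < k.+1)%N), (Ordinal (yk : y < k.+1)%N).
split=> //; have hb := block_perm_inner (a := @ord0 k)
  (x := Ordinal (xk : x < k.+1)%N) (y := Ordinal (yk : y < k.+1)%N)
  (x' := x) (y' := y) erefl erefl.
by rewrite -(op_comp_equiv (jacobi_arity k) el p q hb) perm1 op_act1.
Qed.

Lemma act_tperm_outer (i j l : int) (el : l = i + j) (p : P k.+1 i)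
    (q : P k.+1 j) (x y : 'I_(k + k).+1) : (k < x)%N -> (k < y)%N ->
  exists x' y' : 'I_k.+1, (x' == y') = (x == y) /\
  op_act (tperm x y) (op_comp (jacobi_arity k) el ord0 p q) =
  op_comp (jacobi_arity k) el ord0 (op_act (tperm x' y') p) q.
Proof.
move=> xk yk; have lx : (x - k < k.+1)%N by have := ltn_ord x; lia.
have ly : (y - k < k.+1)%N by have := ltn_ord y; lia.
exists (Ordinal lx), (Ordinal ly).
split; first by rewrite -!(inj_eq val_inj) /=; lia.
have nx : Ordinal lx != ord0 by rewrite -(inj_eq val_inj) /=; lia.
have ny : Ordinal ly != ord0 by rewrite -(inj_eq val_inj) /=; lia.
have ex : x = outer_slot (@ord0 k) k.+1 (Ordinal lx) :> nat.
  by rewrite /outer_slot /=; lia.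
have ey : y = outer_slot (@ord0 k) k.+1 (Ordinal ly) :> nat.
  by rewrite /outer_slot /=; lia.
have hb := block_perm_outer nx ny ex ey.
by rewrite -(op_comp_equiv (jacobi_arity k) el p q hb) tpermD // op_act1.
Qed.

Lemma actA_inner (x y : 'I_(k + k).+1) : (x <= k)%N -> (y <= k)%N ->
  op_act (tperm x y) A = chi (tperm x y) *: A.
Proof.
move=> xk yk; have [x' [y' [e ->]]] := act_tperm_inner eM M nu xk yk.
by rewrite (pois_nu_sym rel) op_compZr -/(chi _) (chi_tperm e).
Qed.

Lemma actA_outer (x y : 'I_(k + k).+1) : (k < x)%N -> (k < y)%N ->
  op_act (tperm x y) A = A.
Proof.
move=> xk yk; have [x' [y' [e ->]]] := act_tperm_outer eM M nu xk yk.
by rewrite op_prod_sym.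
Qed.

Lemma actC_inner (x y : 'I_(k + k).+1) : (x <= k)%N -> (y <= k)%N ->
  op_act (tperm x y) C = C.
Proof.
move=> xk yk; have [x' [y' [e ->]]] := act_tperm_inner eN nu M xk yk.
by rewrite op_prod_sym.
Qed.

Lemma actC_outer (x y : 'I_(k + k).+1) : (k < x)%N -> (k < y)%N ->
  op_act (tperm x y) C = chi (tperm x y) *: C.
Proof.
move=> xk yk; have [x' [y' [e ->]]] := act_tperm_outer eN nu M xk yk.
by rewrite (pois_nu_sym rel) op_compZl -/(chi _) (chi_tperm e).
Qed.

(** Such a [c] only permutes the inputs of [nu] inside [A]: the function [f] merges these inputs and
    separates all others. The permutations supplied by [leibniz_prod] have this form. *)
Lemma actA_fixing (c : 'S_(k + k).+1) :
  (forall u : 'I_(k + k).+1, (k < u)%N -> c u = u) -> op_act c A = chi c *: A.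
Proof.
move=> hc; pose f (u : 'I_(k + k).+1) := if (u <= k)%N then 0%N else val u.
apply: (perm_ind_tperm (f := f) (Pr := fun s => op_act s A = chi s *: A)).
- by rewrite op_act1 chi1 scale1r.
- move=> s x y; rewrite /f => fxy hs; rewrite -op_actM hs op_actZ chiM -scalerA.
  congr (_ *: _); have [xk|xk] := leqP x k; have [yk|yk] := leqP y k.
  + exact: actA_inner.
  + by move: fxy; rewrite xk leqNgt yk /=; lia.
  + by move: fxy; rewrite yk leqNgt xk /=; lia.
  + have -> : y = x.
      by apply/val_inj; move: fxy; rewrite (leqNgt x) xk (leqNgt y) yk /= => ->.
    by rewrite tperm1 op_act1 chi1 scale1r.
- move=> u; rewrite /f; case: (leqP u k) => uk; last by rewrite hc // leqNgt uk.
  case: (leqP (c u) k) => // cu; have /perm_inj e := hc _ cu.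
  by move: cu; rewrite e ltnNge uk.
Qed.

Local Notation T := (op_tensor P P).
Let AC : T (k + k).+1 (dnu + dnu) := tpure erefl A C.
Let CA : T (k + k).+1 (dnu + dnu) := tpure erefl C A.
Let AB : T (k + k).+1 (dnu + dnu) := tpure erefl A B.
Let BA : T (k + k).+1 (dnu + dnu) := tpure erefl B A.

(** On each of the two blocks exactly one tensor factor carries the sign: on the first block [A],
    whose [nu] takes these inputs while [C] multiplies them; on the second block [C], for the same
    reason. *)
Lemma act_young (h : 'S_(k + k).+1) : h \in young_subgroup k ->
  op_act h AC = chi h *: AC /\ op_act h CA = chi h *: CA.
Proof.
rewrite inE => /forallP hh.
pose Pr s := op_act s AC = chi s *: AC /\ op_act s CA = chi s *: CA.
apply: (perm_ind_tperm (f := fun u : 'I_(k + k).+1 => (u <= k)%N) (Pr := Pr)).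
- by rewrite /Pr !op_act1 chi1 !scale1r.
- move=> s x y fxy [hs1 hs2].
  rewrite /Pr -!op_actM hs1 hs2 !op_actZ chiM -!scalerA.
  suff [-> ->] : op_act (tperm x y) AC = chi (tperm x y) *: AC /\
    op_act (tperm x y) CA = chi (tperm x y) *: CA by [].
  rewrite !op_tensor_act; have [xk|xk] := leqP x k.
    have yk : (y <= k)%N by rewrite -fxy.
    by rewrite actA_inner // actC_inner // tpure_Zl tpure_Zr.
  have yk : (k < y)%N by rewrite ltnNge -fxy -ltnNge.
  by rewrite actA_outer // actC_outer // tpure_Zl tpure_Zr.
- by move=> u; rewrite (eqP (hh u)).
Qed.

Lemma B_eq : B = chi (rev_perm k.+1) *: op_act (rev_perm (k + k).+1) A.
Proof.
have := op_comp_equiv (jacobi_arity k) eM M nu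
  (block_perm_rev ord0 (jacobi_arity k)).
rewrite op_prod_sym // (pois_nu_sym rel) op_compZr => <-.
rewrite scalerA chi_sqr scale1r; congr op_comp.
by apply/val_inj; rewrite /= rev_permE subSS subn0.
Qed.

(* The reversal of the slots swaps nu(x_0, ..., x_k) x_(k+1) ... x_(2k) and
   x_0 ... x_(k-1) nu(x_k, ..., x_(2k)), up to the same sign in both directions. *)
Lemma act_rev_AB : op_act (rev_perm (k + k).+1) AB = BA.
Proof.
rewrite op_tensor_act {1}B_eq op_actZ op_actM rev_perm2 op_act1.
by rewrite tpure_Zr -tpure_Zl -B_eq.
Qed.

(** Let e = (-1)^(kd). The reversal has the parity of k, so its character is e; and [dnu * dnu] has
    the parity of 1 - kd, so the other term is -e. *)
Lemma chi_rev : (-1) ^ (dnu * dnu) + chi (rev_perm (k + k).+1) = 0 :> K.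
Proof.
rewrite /sign_char odd_rev_perm signr_odd -[_ ^+ k]/(_ ^ k%:Z) exprz_exp.
have N1 : (-1 : K) != 0 by rewrite oppr_eq0 oner_eq0.
set e : K := _ ^ (k%:Z * d).
have e2 : e ^+ 2 == 1 by rewrite expr2 -expfzMl mulrNN mulr1 exp1rz.
have eo : (-1) ^ dnu = - e^-1 :> K.
  by rewrite /nu_deg expfzDr // expr1z mulN1r invr_expz.
rewrite -exprz_exp eo; move: e2; rewrite sqrf_eq1 => /orP[] /eqP ee.
  by rewrite ee invr1 eo ee invr1 addNr.
by rewrite ee invrN1 opprK exp1rz addrN.
Qed.

(* Multiplying by the order of the Young subgroup replaces the transversal by the
   whole symmetric group; there Leibniz replaces C by multiples of B, and the
   reversal matches the two cross terms with opposite signs. *)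
Lemma jacobi_cross (X : {set 'S_(k + k).+1}) : even_transversal X ->
  \sum_(s in X) op_act s ((-1) ^ (dnu * dnu) *: AC + CA) = 0.
Proof.
case/andP=> tX /'forall_implyP evX.
pose v : T (k + k).+1 (dnu + dnu) := (-1) ^ (dnu * dnu) *: AC + CA.
have hv h : h \in young_subgroup k -> op_act h v = chi h *: v.
  move=> hh; have [h1 h2] := act_young hh.
  by rewrite op_actD op_actZ h1 h2 scalerDr !scalerA mulrC.
(* By [hv], [chi s *: op_act s v] depends only on the coset of [s]; on the transversal the sign
   disappears because its elements are even. *)
have sv : antisym d v = (\sum_(s in X) op_act s v) *+ #|young_subgroup k|.
  rewrite /antisym (sum_transversal tX) => [|h g hh]; last first.
    by rewrite -op_actM hv // op_actZ scalerA chiM mulrAC chi_sqr mul1r.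
  congr (_ *+ _); apply: eq_bigr => s sX.
  by rewrite /sign_char (negbTE (evX _ sX)) expr0 exp1rz scale1r.
have [cs [hcs hC]] := leibniz_prod rel (jacobi_arity k) (jacobi_arity k) eN eM.
(* Each Leibniz permutation [c] acts on [A] by [chi c], so moving it from the factor [B] to the
   whole tensor costs [chi c]; antisymmetrization returns the same sign, and all terms become
   equal. *)
have sAC : antisym d AC = antisym d AB *+ size cs.
  rewrite /AC {1}/C hC tpure_sumr antisym_sum big_seq.
  rewrite (eq_bigr (fun=> antisym d AB)) => [|c /hcs hc].
    by rewrite -big_seq big_const_seq count_predT iter_addr_0.
  rewrite -[RHS]scale1r -(chi_sqr K d c) -scalerA -antisym_act -antisymZ.
  by rewrite op_tensor_act (actA_fixing hc) -tpure_Zl scalerA chi_sqr scale1r.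
have sCA : antisym d CA = antisym d BA *+ size cs.
  rewrite /CA {1}/C hC tpure_suml antisym_sum big_seq.
  rewrite (eq_bigr (fun=> antisym d BA)) => [|c /hcs hc].
    by rewrite -big_seq big_const_seq count_predT iter_addr_0.
  rewrite -[RHS]scale1r -(chi_sqr K d c) -scalerA -antisym_act -antisymZ.
  by rewrite op_tensor_act (actA_fixing hc) -tpure_Zr scalerA chi_sqr scale1r.
have v0 : antisym d v = 0.
  rewrite antisymD antisymZ sAC sCA -act_rev_AB antisym_act -scalerMnr.
  by rewrite -mulrnDl -scalerDl chi_rev scale0r mul0rn.
have y0 : (#|young_subgroup k| == 0%N) = false.
  apply/negbTE; rewrite -lt0n; apply/card_gt0P; exists 1%g.
  by rewrite inE; apply/forallP => j; rewrite perm1.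
(* Characteristic zero permits division by the order of the Young subgroup. *)
have /eqP := sv; rewrite v0 eq_sym -scaler_nat scaler_eq0.
by rewrite ((pcharf0P K).1 char0) y0 /= => /eqP.
Qed.

(** * The relations for the proposed images of the generators *)

Definition mu2 : T 2%N 0 := tpure (esym (addr0 0)) mu mu.
Definition nu2 : T k.+1 dnu := tpure eM M nu + tpure eN nu M.

Lemma pois_relations_tensor : pois_relations mu2 nu2.
Proof.
have e0 : 0 = 0 + 0 :> int := esym (addr0 0).
have addE (V : zmodType) (x y z t : V) : x + y + (z + t) = x + (y + z) + t.
  by rewrite !addrA.
split=> [s||s|X hX|mu_nu].
- by rewrite op_tensor_act mu_sym.
- rewrite !(op_tensor_comp _ _ _ _ _ _ _ _ _ e0 (esym (addr0 0)) (esym (addr0 0))).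
  by rewrite mu_assoc.
- rewrite op_actD !op_tensor_act op_prod_sym // (pois_nu_sym rel).
  by rewrite tpure_Zl tpure_Zr scalerDr.
(* Of the four products only (M (x) nu) o_0 (nu (x) M) interchanges two copies of [nu], whence the
   sign before [AC]. *)
- have -> : op_comp (jacobi_arity k) erefl ord0 nu2 nu2 =
      tpure (esym (add0r (dnu + dnu))) (op_comp (jacobi_arity k) e0 ord0 M M)
        (op_comp (jacobi_arity k) erefl ord0 nu nu) +
      ((-1) ^ (dnu * dnu) *: AC + CA) +
      tpure (esym (addr0 (dnu + dnu))) (op_comp (jacobi_arity k) erefl ord0 nu nu)
        (op_comp (jacobi_arity k) e0 ord0 M M).
    rewrite op_compDl !op_compDr.
    rewrite (op_tensor_comp _ _ _ _ _ _ _ _ _ (esym (add0r (dnu + dnu))) e0 erefl).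
    rewrite (op_tensor_comp _ _ _ _ _ _ _ _ _ erefl eM eN).
    rewrite (op_tensor_comp _ _ _ _ _ _ _ _ _ erefl eN eM).
    rewrite (op_tensor_comp _ _ _ _ _ _ _ _ _ (esym (addr0 (dnu + dnu))) erefl e0).
    rewrite !(mul0r, mulr0) expr0z !scale1r; apply: addE.
  have sumD u v : \sum_(s in X) op_act s (u + v : T (k + k).+1 (dnu + dnu)) =
      \sum_(s in X) op_act s u + \sum_(s in X) op_act s v.
    by rewrite -big_split; apply: eq_bigr => s _; apply: op_actD.
  (* M o_0 M is again an iterated product, hence invariant, so it factors out of the sum and leaves
     the Jacobi identity of [nu]. *)
  have MM s : op_act s (op_comp (jacobi_arity k) e0 ord0 M M) =
      op_comp (jacobi_arity k) e0 ord0 M M.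
    by rewrite op_prod_comp // op_prod_sym.
  have J1 (e : dnu + dnu = 0 + (dnu + dnu)) : \sum_(s in X) op_act s
      (tpure e (op_comp (jacobi_arity k) e0 ord0 M M)
         (op_comp (jacobi_arity k) erefl ord0 nu nu) : T _ _) = 0.
    under eq_bigr do rewrite op_tensor_act MM.
    by rewrite -tpure_sumr (pois_jacobi rel hX) tpure0r.
  have J2 (e : dnu + dnu = (dnu + dnu) + 0) : \sum_(s in X) op_act s
      (tpure e (op_comp (jacobi_arity k) erefl ord0 nu nu)
         (op_comp (jacobi_arity k) e0 ord0 M M) : T _ _) = 0.
    under eq_bigr do rewrite op_tensor_act MM.
    by rewrite -tpure_suml (pois_jacobi rel hX) tpure0l.
  apply: etrans (etrans (sumD _ _) (congr2 +%R
    (etrans (sumD _ _) (congr2 +%R (J1 _) (jacobi_cross hX))) (J2 _))) _.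
  by rewrite !addr0.
- rewrite /mu_nu.
  (* Both M o mu and mu o M are the symmetric product of k + 2 arguments, so in each summand of
     [nu2] the identity reduces to Leibniz in the other factor. *)
  have MS : op_comp (leibniz_arity k) e0 ord_max M mu = op_prod mu k.+1.
    rewrite -[in RHS](op_prod_comp mu_sym mu_assoc (leibniz_arity k) e0 ord_max).
    by congr op_comp; rewrite /= op_comp_unitr.
  have MS0 : op_comp (erefl : k.+3 = (2 + k.+1)%N) e0 ord0 mu M = op_prod mu k.+1.
    exact: op_comp_irr.
  have -> : op_comp (leibniz_arity k) (esym (addr0 dnu)) ord_max nu2 mu2 =
      tpure eM (op_prod mu k.+1) (op_comp (leibniz_arity k) eN ord_max nu mu) +
      tpure eN (op_comp (leibniz_arity k) eN ord_max nu mu) (op_prod mu k.+1).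
    rewrite op_compDl (op_tensor_comp _ _ _ _ _ _ _ _ _ eM e0 eN).
    rewrite (op_tensor_comp _ _ _ _ _ _ _ _ _ eN eN e0).
    by rewrite !mulr0 expr0z !scale1r MS.
  have -> : op_comp (erefl : k.+3 = (2 + k.+1)%N) eM ord0 mu2 nu2 =
      tpure eM (op_prod mu k.+1)
        (op_comp (erefl : k.+3 = (2 + k.+1)%N) eM ord0 mu nu) +
      tpure eN (op_comp (erefl : k.+3 = (2 + k.+1)%N) eM ord0 mu nu)
        (op_prod mu k.+1).
    rewrite op_compDr (op_tensor_comp _ _ _ _ _ _ _ _ _ eM e0 eM).
    rewrite (op_tensor_comp _ _ _ _ _ _ _ _ _ eN eM e0).
    by rewrite mulr0 mul0r expr0z !scale1r MS0.
  rewrite op_actD !op_tensor_act op_prod_sym // (pois_leibniz rel).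
  rewrite tpureDl tpureDr; apply: addrACA.
Qed.
End Jacobi.

Theorem lemma10 (K : fieldType) (char0 : [pchar K] =i pred0)
    (k : nat) (k_ge1 : (1 <= k)%N) (d : int) :
  exists D : hopf_structure (Pois K k d),
    extends_generators D /\
    forall D' : operad_hom (Pois K k d) (op_tensor (Pois K k d) (Pois K k d)),
      extends_generators D' ->
      forall (n : nat) (i : int) (x : Pois K k d n i), D' n i x = D n i x.
Proof.
pose T := PoisModel (pois_relations_tensor (Pois_relations K k d) char0).
have gD : extends_generators (pois_hom T).
  by split; [apply: (pois_hom_mu T)|apply: (pois_hom_nu T)].
exists (HopfStructure (extends_coassociative gD)); split=> // D' [hmu hnu].
by apply: pois_hom_ext; rewrite ?hmu ?hnu; case: gD.
Qed.
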